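(* If $x=\sum_{n=1}^\infty\lambda_nP_n$ is an infinite dimensional (infinite rank) normal operator in $L(s',s)$ (given by its spectral representation), then the map $$\Phi\colon C_s(\sigma(x))\to\operatorname{alg}(x),\qquad \Phi(f):=f(x):=\sum_{n=1}^\infty f(\lambda_n)P_n$$ is a Fréchet algebra isomorphism such that $\Phi(\operatorname{id})=x$ and $\Phi(\overline f)=\Phi(f)^*$ for all $f\in C_s(\sigma(x))$.
   Context: $\mathbb N=\{1,2,\dots\}$, $\mathbb N_0=\mathbb N\cup\{0\}$. $s$ is the Fréchet space of complex sequences $\xi=(\xi_j)_{j\in\mathbb N}$ with $|\xi|_q:=(\sum_{j}|\xi_j|^2j^{2q})^{1/2}<\infty$ for all $q\in\mathbb N_0$, with the topology of the norms $(|\cdot|_q)_{q\in\mathbb N_0}$. $s'$ is the space of complex sequences with $|\xi|'_q:=(\sum_j|\xi_j|^2j^{-2q})^{1/2}<\infty$ for some $q\in\mathbb N_0$, with the inductive limit topology. Note $s\subset l_2\subset s'$ continuously. $L(s',s)$ is the Fréchet space of continuous linear operators $x:s'\to s$ with norms $\|x\|_q:=\sup_{|\xi|'_q\le1}|x\xi|_q$, $q\in\mathbb N_0$. It is an algebra under composition (using $s\subset s'$). Restriction to $l_2$ embeds $L(s',s)$ into the compact operators $K(l_2)$; via this embedding $L(s',s)$ is regarded as a subalgebra of $K(l_2)$, closed under the Hilbert space adjoint $x\mapsto x^*$, which is its (continuous) involution. A projection is a continuous orthogonal (self-adjoint) projection on $l_2$. The spectral representation of an infinite rank normal $x\in L(s',s)$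 is $x=\sum_{n=1}^\infty\lambda_nP_n$ with $\lambda_n$ nonzero, pairwise different, $|\lambda_1|\ge|\lambda_2|\ge\cdots$, $(\lambda_n)\in s$, $P_n$ nonzero pairwise orthogonal finite dimensional projections in $L(s',s)$, the series converging absolutely in $L(s',s)$. Then the spectrum is $\sigma(x)=\{0\}\cup\{\lambda_n:n\in\mathbb N\}$. $\operatorname{alg}(x)$ is the closed ${}^*$-subalgebra of $L(s',s)$ generated by $x$. Define $$C_s(\sigma(x)):=\{f:\sigma(x)\to\mathbb C:\ f(0)=0,\ c_q(f):=\sup_{n\in\mathbb N}|f(\lambda_n)|\,\|P_n\|_q<\infty\text{ for all }q\in\mathbb N_0\},$$ which, with the seminorms $(c_q)_{q\in\mathbb N_0}$, pointwise multiplication and complex conjugation, is a Fréchet ${}^*$-algebra. $\operatorname{id}$ is the identity function on $\sigma(x)$. A Fréchet algebra isomorphism is an algebra isomorphism that is a homeomorphism. *)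

(* Defs.v *)
From HB Require Import structures.
From mathcomp Require Import all_boot all_order all_algebra.
From mathcomp Require Import all_classical all_reals all_analysis.
From mathcomp Require Import complex.

Set Implicit Arguments.
Unset Strict Implicit.
Unset Printing Implicit Defensive.

Import Order.TTheory GRing.Theory Num.Theory.
Import numFieldNormedType.Exports.
Export ComplexField.Normc(normc).

Local Open Scope classical_set_scope.
Local Open Scope ring_scope.

Section weighted_norm.
Variable R : realType.
Implicit Types (k : int) (xi eta : nat -> R[i]).
Local Open Scope ereal_scope.

(* For q : nat, [wnorm q] is $|\cdot|_q$, [wnorm (- q)] is $|\cdot|'_q$ and
   [wnorm 0] is the $\ell_2$-norm.  The term of (0-based) index j of a
   sequence has weight j.+1, so that weights range over 1, 2, 3, ... *)
Definition wnorm k xi : \bar R :=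
  sqrte (\sum_(0 <= j <oo) (normc (xi j) ^+ 2 * j.+1%:R ^ (2 * k))%:E).

Lemma normc_ge0 (z : R[i]) : (0 <= normc z)%R.
Proof. by case: z => a b; rewrite sqrtr_ge0. Qed.

Lemma wnormE k xi : wnorm k xi =
  Lnorm (@counting nat R) 2%:E (EFin \o (fun j => (normc (xi j) * j.+1%:R ^ k)%R)).
Proof.
rewrite Lnorm_counting// /wnorm -poweR12_sqrt; last first.
  apply: nneseries_ge0 => j _ _.
  by rewrite lee_fin mulr_ge0// ?sqr_ge0// exprz_ge0.
congr (_ `^ _); apply: eq_eseriesr => j _ /=.
rewrite powR_mulrn// real_normK ?num_real//.
rewrite exprMn; congr (_ * _)%:E.
by rewrite [in RHS]exprnP exprz_exp mulrC.
Qed.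

Lemma wnorm_ge0 k xi : 0 <= wnorm k xi.
Proof. exact: sqrte_ge0. Qed.

Lemma wnorm0 k : wnorm k 0%R = 0.
Proof.
rewrite /wnorm eseries0 ?sqrte0// => j _ _.
by rewrite ComplexField.Normc.normc0 expr0n mul0r.
Qed.

Lemma wnormD k xi eta : wnorm k (xi + eta)%R <= wnorm k xi + wnorm k eta.
Proof.
rewrite !wnormE.
apply: (@le_trans _ _ (Lnorm (@counting nat R) 2%:E (EFin \o
  ((fun j => (normc (xi j) * j.+1%:R ^ k)%R) \+
   (fun j => (normc (eta j) * j.+1%:R ^ k)%R))%R))); last first.
  by apply: minkowski_EFin => //; rewrite ler1n.
rewrite !Lnorm_counting//; apply: gt0_ler_poweR; rewrite ?invr_ge0//.
- by rewrite in_itv/= leey andbT nneseries_ge0// => *; exact: poweR_ge0.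
- by rewrite in_itv/= leey andbT nneseries_ge0// => *; exact: poweR_ge0.
apply: lee_nneseries => j _ //.
  by move=> *; exact: poweR_ge0.
rewrite /= lee_fin ge0_ler_powR ?nnegrE// !ger0_norm/= ?addr_ge0 ?mulr_ge0 ?normc_ge0 ?exprz_ge0//.
by rewrite -mulrDl ler_wpM2r ?exprz_ge0// le_normcD.
Qed.

Lemma wnormZ k (a : R[i]) xi : wnorm k (a *: xi)%R = (normc a)%:E * wnorm k xi.
Proof.
rewrite /wnorm.
under eq_eseriesr => j _.
  have -> : (normc ((a *: xi) j) ^+ 2 * j.+1%:R ^ (2 * k))%:E =
    (normc a ^+ 2)%:E * (normc (xi j) ^+ 2 * j.+1%:R ^ (2 * k))%:E :> \bar R.
    by rewrite -EFinM mulrA -exprMn -ComplexField.Normc.normcM.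
  over.
rewrite nneseriesZl; last first.
  by move=> j _; rewrite lee_fin mulr_ge0// ?sqr_ge0// exprz_ge0.
rewrite sqrteM ?lee_fin ?sqr_ge0//; congr (_ * _).
by rewrite EFin_expe sqrte_sqr gee0_abs// lee_fin normc_ge0.
Qed.

Lemma wnorm_le k l xi : (k <= l)%R -> wnorm k xi <= wnorm l xi.
Proof.
move=> kl; rewrite /wnorm lee_sqrt; last first.
  apply: nneseries_ge0 => j _ _.
  by rewrite lee_fin mulr_ge0// ?sqr_ge0// exprz_ge0.
apply: lee_nneseries => j; first by move=> _ _; rewrite lee_fin mulr_ge0// ?sqr_ge0// exprz_ge0.
move=> _; rewrite lee_fin ler_wpM2l ?sqr_ge0//.
by rewrite ler_weXz2l ?ler1n// ler_pM2l.
Qed.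

Lemma wnorm_lin_lty k (a : R[i]) xi eta : wnorm k xi < +oo -> wnorm k eta < +oo ->
  wnorm k (a *: xi + eta)%R < +oo.
Proof.
move=> xoo eoo; apply: le_lt_trans (wnormD _ _ _) _.
by rewrite lte_add_pinfty// wnormZ lte_mul_pinfty// lee_fin normc_ge0.
Qed.

End weighted_norm.

Section seminorm_topology.
Variables (R : realType) (E : zmodType) (p : nat -> E -> \bar R).

(* The seminorms take extended values, so that no finiteness proof is needed to
   define the topology. *)
Definition seminorm_nbhs (x : E) : set_system E :=
  [set A | exists (q : nat) (e : R), 0 < e /\
     forall y, (forall k, (k <= q)%N -> (p k (y - x)%R < e%:E)%E) -> A y].

Hypothesis p0 : forall k, p k 0 = 0%E.
Hypothesis pD : forall k x y, (p k (x + y)%R <= p k x + p k y)%E.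

Lemma seminorm_nbhs_filter x : ProperFilter (seminorm_nbhs x).
Proof.
split.
  move=> [q [e [e0 h]]]; apply: (h x) => k _.
  by rewrite subrr p0 lte_fin.
split.
- by exists 0%N, 1; split.
- move=> A B [q [e [e0 hA]]] [r [d [d0 hB]]].
  exists (maxn q r), (Num.min e d); split; first by rewrite lt_min e0.
  move=> y hy; split.
    apply: hA => k kq; have := hy k; rewrite leq_max kq => /(_ isT).
    by move=> /lt_le_trans; apply; rewrite lee_fin ge_min lexx.
  apply: hB => k kq; have := hy k; rewrite leq_max kq orbT => /(_ isT).
  by move=> /lt_le_trans; apply; rewrite lee_fin ge_min lexx orbT.
- by move=> A B AB [q [e [e0 h]]]; exists q, e; split => // y /h /AB.
Qed.

Lemma seminorm_nbhs_singleton x A : seminorm_nbhs x A -> A x.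
Proof.
by move=> [q [e [e0 h]]]; apply: h => k _; rewrite subrr p0 lte_fin.
Qed.

Lemma seminorm_nbhs_nbhs x A :
  seminorm_nbhs x A -> seminorm_nbhs x (seminorm_nbhs^~ A).
Proof.
move=> [q [e [e0 h]]]; exists q, (e / 2); split; first by rewrite divr_gt0.
move=> y hy; exists q, (e / 2); split; first by rewrite divr_gt0.
move=> z hz; apply: h => k kq.
rewrite -(subrKA y); apply: le_lt_trans (pD _ _ _) _.
by rewrite [e]splitr EFinD lteD// ?hz ?hy.
Qed.

End seminorm_topology.

Section sequence_spaces.
Variable R : realType.

Definition s_pred : {pred nat -> R[i]} :=
  [pred xi | `[< forall q : nat, (wnorm q xi < +oo)%E >]].

Definition l2_pred : {pred nat -> R[i]} :=
  [pred xi | `[< (wnorm 0 xi < +oo)%E >]].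

Definition sdual_pred : {pred nat -> R[i]} :=
  [pred xi | `[< exists q : nat, (wnorm (- q%:Z) xi < +oo)%E >]].

Lemma s_submod_closed : submod_closed s_pred.
Proof.
split; first by apply/asboolP => q; rewrite wnorm0.
move=> a xi eta /asboolP hx /asboolP he; apply/asboolP => q.
exact: wnorm_lin_lty.
Qed.

Lemma l2_submod_closed : submod_closed l2_pred.
Proof.
split; first by apply/asboolP; rewrite wnorm0.
move=> a xi eta /asboolP hx /asboolP he; apply/asboolP.
exact: wnorm_lin_lty.
Qed.

Lemma sdual_submod_closed : submod_closed sdual_pred.
Proof.
split; first by apply/asboolP; exists 0%N; rewrite wnorm0.
move=> a xi eta /asboolP[q hx] /asboolP[r he]; apply/asboolP.
exists (maxn q r).
have lq : - (maxn q r)%:Z <= - q%:Z by rewrite lerN2 lez_nat leq_maxl.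
have lr : - (maxn q r)%:Z <= - r%:Z by rewrite lerN2 lez_nat leq_maxr.
by apply: wnorm_lin_lty;
  [exact: le_lt_trans (wnorm_le xi lq) hx|exact: le_lt_trans (wnorm_le eta lr) he].
Qed.

HB.instance Definition _ := GRing.isSubmodClosed.Build _ _ s_pred s_submod_closed.
HB.instance Definition _ := GRing.isSubmodClosed.Build _ _ l2_pred l2_submod_closed.
HB.instance Definition _ :=
  GRing.isSubmodClosed.Build _ _ sdual_pred sdual_submod_closed.

Record sspace := SSpace { sval :> nat -> R[i]; _ : sval \in s_pred }.
Record l2space := L2Space { l2val :> nat -> R[i]; _ : l2val \in l2_pred }.
Record sdual := SDual { sdualval :> nat -> R[i]; _ : sdualval \in sdual_pred }.

HB.instance Definition _ := [isSub for sval].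
HB.instance Definition _ := [Choice of sspace by <:].
HB.instance Definition _ := [SubChoice_isSubLmodule of sspace by <:].

HB.instance Definition _ := [isSub for l2val].
HB.instance Definition _ := [Choice of l2space by <:].
HB.instance Definition _ := [SubChoice_isSubLmodule of l2space by <:].

HB.instance Definition _ := [isSub for sdualval].
HB.instance Definition _ := [Choice of sdual by <:].
HB.instance Definition _ := [SubChoice_isSubLmodule of sdual by <:].

Lemma s_sub_l2 (xi : sspace) : \val xi \in l2_pred.
Proof. by case: xi => xi /= /asboolP h; apply/asboolP; exact: (h 0%N). Qed.

Lemma l2_sub_sdual (xi : l2space) : \val xi \in sdual_pred.
Proof. by case: xi => xi /= /asboolP h; apply/asboolP; exists 0%N. Qed.

Definition s_to_l2 (xi : sspace) : l2space := L2Space (s_sub_l2 xi).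
Definition l2_to_sdual (xi : l2space) : sdual := SDual (l2_sub_sdual xi).
Definition s_to_sdual (xi : sspace) : sdual := l2_to_sdual (s_to_l2 xi).

HB.instance Definition _ := hasNbhs.Build sspace
  (seminorm_nbhs (fun q (xi : sspace) => wnorm q (\val xi))).

Lemma s_p0 k : wnorm (R:=R) k (\val (0 : sspace)) = 0%E.
Proof. exact: wnorm0. Qed.

Lemma s_pD k (x y : sspace) :
  (wnorm k (\val (x + y)%R) <= wnorm k (\val x) + wnorm k (\val y))%E.
Proof. exact: wnormD. Qed.

HB.instance Definition _ := Nbhs_isNbhsTopological.Build sspace
  (seminorm_nbhs_filter (fun k => s_p0 k))
  (seminorm_nbhs_singleton (fun k => s_p0 k))
  (seminorm_nbhs_nbhs (fun k => @s_pD k)).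

Definition absolutely_convex (V : set sdual) :=
  V 0 /\ forall xi eta (a b : R[i]), V xi -> V eta ->
    normc a + normc b <= 1 -> V (a *: xi + b *: eta).

(* The locally convex inductive limit topology on $s' = \bigcup_q s'_q$, where
   $s'_q$ is the Hilbert space normed by [wnorm (- q)]: an absolutely convex
   set is a neighbourhood of 0 iff its trace on each $s'_q$ is one *)
Definition sdual_nbhs (xi : sdual) : set_system sdual :=
  [set A | exists V : set sdual, [/\ absolutely_convex V,
     (forall q : nat, exists2 e : R, 0 < e &
        forall eta : sdual, (wnorm (- q%:Z) (\val eta) < e%:E)%E -> V eta) &
     forall eta, V eta -> A (xi + eta)]].

HB.instance Definition _ := hasNbhs.Build sdual sdual_nbhs.

Lemma sdual_nbhs_filter (xi : sdual) : ProperFilter (nbhs xi).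
Proof.
split; first by move=> [V [[V0 _] _ h]]; exact: (h 0).
split.
- exists setT; split => //.
  by move=> q; exists 1.
- move=> A B [V [[V0 cV] nV hV]] [W [[W0 cW] nW hW]].
  exists (V `&` W); split.
  + split=> // x y a b [? ?] [? ?] ?; split; [exact: cV|exact: cW].
  + move=> q; have [e e0 he] := nV q; have [d d0 hd] := nW q.
    exists (Num.min e d); first by rewrite lt_min e0.
    move=> eta h; split; [apply: he|apply: hd];
      by apply: lt_le_trans h _; rewrite lee_fin ge_min lexx ?orbT.
  + by move=> eta [/hV ? /hW].
- move=> A B AB [V [cV nV hV]]; exists V; split => //.
  by move=> eta /hV /AB.
Qed.

Lemma sdual_nbhs_singleton (xi : sdual) A : nbhs xi A -> A xi.
Proof. by move=> [V [[V0 _] _ h]]; rewrite -[xi]addr0; exact: h. Qed.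

Lemma sdual_nbhs_nbhs (xi : sdual) A : nbhs xi A -> nbhs xi (nbhs^~ A).
Proof.
have n2 : normc (2^-1 : R[i]) = 2^-1.
  apply: complexI; rewrite -[LHS]/(`|2^-1 : R[i]|) normfV ger0_norm//.
  by rewrite fmorphV rmorph_nat.
move=> [V [[V0 cV] nV hV]].
exists [set x | V (2 *: x)].
have nW (q : nat) : exists2 e : R, 0 < e & forall eta : sdual,
    (wnorm (- q%:Z) (\val eta) < e%:E)%E -> V (2 *: eta).
  have [e e0 he] := nV q; exists (e / 2); first by rewrite divr_gt0.
  move=> eta h; apply: he; rewrite /= wnormZ.
  have -> : normc (2 : R[i]) = 2 by rewrite -[2 in LHS]invrK ComplexField.Normc.normcV n2 invrK.
  by rewrite -lte_pdivlMl// -EFinM mulrC.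
have cW : absolutely_convex [set x | V (2 *: x)].
  split=> /=; first by rewrite scaler0.
  move=> x y a b Vx Vy ab; rewrite scalerDr !scalerA ![2 * _]mulrC -!scalerA.
  exact: cV.
split=> // eta Veta; exists [set x | V (2 *: x)]; split => // zeta Vzeta.
rewrite -addrA; apply: hV.
have -> : eta + zeta = 2^-1 *: (2 *: eta) + 2^-1 *: (2 *: zeta).
  by rewrite !scalerA mulVf// !scale1r.
by apply: cV => //; rewrite n2 [leRHS]splitr !mul1r.
Qed.

HB.instance Definition _ := Nbhs_isNbhsTopological.Build sdual
  sdual_nbhs_filter sdual_nbhs_singleton sdual_nbhs_nbhs.

Lemma s_to_sdual_continuous : continuous s_to_sdual.
Proof.
move=> xi A [V [_ nV hV]]; have [e e0 he] := nV 0%N.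
exists 0%N, e; split => // y /(_ 0%N isT) hy.
rewrite /= -[s_to_sdual y](subrKC (s_to_sdual xi)); apply: hV; exact: he.
Qed.

End sequence_spaces.

Section operators.
Variable R : realType.

Definition Lss_pred : {pred sdual R -> sspace R} :=
  [pred f | `[< linear f /\ continuous f >]].

Lemma Lss_submod_closed : submod_closed Lss_pred.
Proof.
split.
  apply/asboolP; split; first by move=> a u v; rewrite -[RHS]/(a *: 0 + 0) scaler0 addr0.
  exact: cst_continuous.
move=> a f g /asboolP[lf cf] /asboolP[lg cg]; apply/asboolP; split.
  move=> b u v; rewrite -[LHS]/(a *: f (b *: u + v) + g (b *: u + v)).
  rewrite -[RHS]/(b *: (a *: f u + g u) + (a *: f v + g v)) lf lg.
  by rewrite !scalerDr !scalerA [b * a]mulrC addrACA.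
move=> xi A [q [e [e0 h]]].
pose d := e / 2 / (normc a + 1).
have a1 : 0 < normc a + 1 by rewrite ltr_wpDl// normc_ge0.
have d0 : 0 < d by rewrite !divr_gt0.
pose ball (z : sspace R) (c : R) : set (sspace R) :=
  [set y | forall k, (k <= q)%N -> (wnorm k (\val (y - z)%R) < c%:E)%E].
have nf : nbhs xi (f @^-1` ball (f xi) d) by apply: (cf xi); exists q, d.
have ng : nbhs xi (g @^-1` ball (g xi) (e / 2)).
  by apply: (cg xi); exists q, (e / 2); split; first by rewrite divr_gt0.
apply: (filterS2 _ _ nf ng) => y /= hf hg; apply: h => k kq.
rewrite -[X in wnorm _ (\val X)]/(a *: f y + g y - (a *: f xi + g xi)).
rewrite opprD addrACA -scalerBr.
apply: le_lt_trans (wnormD _ _ _) _.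
rewrite [e]splitr EFinD lteD// ?hg//.
rewrite [X in wnorm _ X]/= wnormZ.
apply: (@le_lt_trans _ _ ((normc a)%:E * d%:E)%E).
  by rewrite lee_wpmul2l// ?lee_fin ?normc_ge0// ltW// hf.
rewrite -EFinM lte_fin /d mulrCA gtr_pMr ?divr_gt0//.
by rewrite ltr_pdivrMr// mul1r ltrDl.
Qed.

HB.instance Definition _ :=
  GRing.isSubmodClosed.Build _ _ Lss_pred Lss_submod_closed.

Record Lss := MkLss { Lssval :> sdual R -> sspace R; _ : Lssval \in Lss_pred }.

HB.instance Definition _ := [isSub for Lssval].
HB.instance Definition _ := [Choice of Lss by <:].
HB.instance Definition _ := [SubChoice_isSubLmodule of Lss by <:].

Lemma Lss_linear (x : Lss) : linear x.
Proof. by case: x => f /= /asboolP[]. Qed.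

Lemma Lss_continuous (x : Lss) : continuous x.
Proof. by case: x => f /= /asboolP[]. Qed.

Lemma Lmul_subproof (x y : Lss) :
  (fun xi => x (s_to_sdual (y xi))) \in Lss_pred.
Proof.
apply/asboolP; split.
  move=> a u v; rewrite Lss_linear.
  have -> : s_to_sdual (a *: y u + y v) =
      a *: s_to_sdual (y u) + s_to_sdual (y v) by exact: val_inj.
  by rewrite Lss_linear.
move=> xi.
apply: (@continuous_comp _ _ _ y (fun z => x (s_to_sdual z)) xi).
  exact: Lss_continuous.
apply: (@continuous_comp _ _ _ (@s_to_sdual R) x (y xi)).
  exact: s_to_sdual_continuous.
exact: Lss_continuous.
Qed.

(* The product of $L(s', s)$: composition through the inclusion of $s$ in
   $s'$ *)
Definition Lmul (x y : Lss) : Lss := MkLss (Lmul_subproof x y).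

Definition opnorm (q : nat) (x : Lss) : \bar R :=
  ereal_sup [set wnorm q (\val (x xi)) |
    xi in [set xi : sdual R | (wnorm (- q%:Z) (\val xi) <= 1)%E]].

Lemma opnorm_ub q (x : Lss) (xi : sdual R) :
  (wnorm (- q%:Z) (\val xi) <= 1)%E -> (wnorm q (\val (x xi)) <= opnorm q x)%E.
Proof. by move=> h; apply: ereal_sup_ubound; exists xi. Qed.

Lemma opnorm_ge0 q (x : Lss) : (0 <= opnorm q x)%E.
Proof.
apply: le_trans (opnorm_ub (xi := 0) _ _); first exact: wnorm_ge0.
by rewrite wnorm0.
Qed.

Lemma opnorm0 q : opnorm q 0 = 0%E.
Proof.
apply/eqP; rewrite eq_le opnorm_ge0 andbT.
by apply: ge_ereal_sup => _ [xi _ <-]; rewrite wnorm0.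
Qed.

Lemma opnormD q (x y : Lss) : (opnorm q (x + y)%R <= opnorm q x + opnorm q y)%E.
Proof.
apply: ge_ereal_sup => _ [xi hxi <-].
rewrite -[\val ((x + y)%R xi)]/(\val (x xi) + \val (y xi)).
apply: le_trans (wnormD q (\val (x xi)) (\val (y xi))) _.
by apply: leeD; exact: opnorm_ub.
Qed.

Lemma opnormZ q (a : R[i]) (x : Lss) :
  opnorm q (a *: x) = ((normc a)%:E * opnorm q x)%E.
Proof.
rewrite /opnorm -ereal_supZl ?normc_ge0//; last first.
  apply/set0P; exists (wnorm q (\val (x 0))), 0 => //=.
  by rewrite wnorm0.
have E xi : wnorm q (\val ((a *: x) xi)) = ((normc a)%:E * wnorm q (\val (x xi)))%E.
  by rewrite -[\val ((a *: x) xi)]/(a *: \val (x xi)) wnormZ.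
congr ereal_sup; apply/seteqP; split.
  by move=> _ [xi hxi <-]; exists (wnorm q (\val (x xi))); [exists xi|rewrite E].
by move=> _ [_ [xi hxi <-] <-]; exists xi; rewrite //= E.
Qed.

HB.instance Definition _ := hasNbhs.Build Lss (seminorm_nbhs opnorm).

HB.instance Definition _ := Nbhs_isNbhsTopological.Build Lss
  (seminorm_nbhs_filter opnorm0)
  (seminorm_nbhs_singleton opnorm0)
  (seminorm_nbhs_nbhs opnormD).

Definition l2op (x : Lss) (xi : l2space R) : l2space R :=
  s_to_l2 (x (l2_to_sdual xi)).

(* Componentwise sum of a complex series *)
Definition csum (u : nat -> R[i]) : R[i] :=
  Complex (limn (series (fun j => complex.Re (u j))))
          (limn (series (fun j => complex.Im (u j)))).

Definition l2inner (xi eta : l2space R) : R[i] :=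
  csum (fun j => xi j * conjc (eta j)).

(* y is the Hilbert space adjoint $x^*$.  It is stated as a relation: y is
   determined by x because $\ell_2$ is dense in $s'$. *)
Definition is_adjoint (x y : Lss) :=
  forall xi eta, l2inner (l2op x xi) eta = l2inner xi (l2op y eta).

Definition is_normal (x : Lss) :=
  exists2 y, is_adjoint x y & Lmul x y = Lmul y x.

Definition is_projection (P : Lss) := Lmul P P = P /\ is_adjoint P P.

(* Rank of the restriction to $\ell_2$ *)
Definition finite_rank (x : Lss) :=
  exists (m : nat) (v : 'I_m -> l2space R), forall xi, exists c : 'I_m -> R[i],
    l2op x xi = \sum_i c i *: v i.

Definition l2bounded (T : l2space R -> l2space R) :=
  exists M : R, forall xi, (wnorm 0 (\val (T xi)) <= M%:E * wnorm 0 (\val xi))%E.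

(* The spectrum in the algebra of bounded operators on $\ell_2$; the elements of
   $L(s', s)$ act there as compact operators *)
Definition spectrum (x : Lss) : set R[i] :=
  [set mu | ~ exists T : l2space R -> l2space R,
     [/\ linear T, l2bounded T,
         forall xi, T (l2op x xi - mu *: xi) = xi &
         forall xi, l2op x (T xi) - mu *: T xi = xi]].

Definition closed_star_subalgebra (A : set Lss) :=
  [/\ A 0,
      forall (a : R[i]) y z, A y -> A z -> A (a *: y + z),
      forall y z, A y -> A z -> A (Lmul y z),
      forall y z, A y -> is_adjoint y z -> A z &
      closed A].

Definition alg (x : Lss) : set Lss :=
  \bigcap_(A in [set A | closed_star_subalgebra A /\ A x]) A.

Record spectral_repr (x : Lss) := SpectralRepr {
  ev : nat -> R[i];
  evproj : nat -> Lss;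
  ev_neq0 : forall n, ev n != 0;
  ev_inj : injective ev;
  ev_noninc : forall n, normc (ev n.+1) <= normc (ev n);
  ev_in_s : ev \in @s_pred R;
  evproj_neq0 : forall n, evproj n != 0;
  evproj_projection : forall n, is_projection (evproj n);
  evproj_finite_rank : forall n, finite_rank (evproj n);
  evproj_orthogonal : forall m n, m != n -> Lmul (evproj m) (evproj n) = 0;
  spectral_abs_cvg : forall q : nat,
    (\sum_(0 <= n <oo) opnorm q (ev n *: evproj n) < +oo)%E;
  spectral_cvg : series (fun n => ev n *: evproj n) @ \oo --> x
}.

Lemma wnorm_eq0 k (xi : nat -> R[i]) : wnorm k xi = 0%E -> xi = 0.
Proof.
move=> h; apply/funext => j; apply: ComplexField.Normc.eq0_normc.
have t0 i : true -> (0%E <= (normc (xi i) ^+ 2 * i.+1%:R ^ (2 * k))%:E)%E.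
  by move=> _; rewrite lee_fin mulr_ge0// ?sqr_ge0// exprz_ge0.
have : (\sum_(0 <= i <oo) (normc (xi i) ^+ 2 * i.+1%:R ^ (2 * k))%:E)%E = 0%E.
  apply/eqP; rewrite eq_le nneseries_ge0 ?andbT; last by move=> i _; exact: t0.
  by rewrite -lee_sqrt// sqrte0 -[leLHS]/(wnorm k xi) h.
rewrite (@nneseriesD1 _ _ j)//.
move=> /eqP; rewrite padde_eq0 ?t0//; last first.
  by apply: nneseries_ge0 => i _ _; exact: t0.
move=> /andP[/eqP[]/eqP + _]; rewrite mulf_eq0 sqrf_eq0 => /orP[/eqP//|].
by rewrite expfz_eq0 pnatr_eq0 andbF.
Qed.

Lemma opnorm_projection (P : Lss) :
  P != 0 -> Lmul P P = P -> (1 <= opnorm 0 P)%E.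
Proof.
move=> P0 PP.
have [xi Pxi] : exists xi, P xi != 0.
  apply: contrapT => /forallNP h; move/eqP: P0; apply; apply/val_inj.
  by apply/funext => xi; apply/eqP; have /negP := h xi; rewrite negbK.
pose v := s_to_sdual (P xi).
have Pv : P v = P xi by rewrite -[in RHS]PP.
have vfin : wnorm 0 (\val (P xi)) \is a fin_num.
  rewrite ge0_fin_numE ?wnorm_ge0//.
  by have := s_sub_l2 (P xi) => /asboolP.
pose r := fine (wnorm 0 (\val (P xi))).
have rE : wnorm 0 (\val (P xi)) = r%:E by rewrite fineK.
have r0 : 0 < r.
  rewrite -lte_fin -rE lt_neqAle wnorm_ge0 andbT eq_sym.
  by apply: contra Pxi => /eqP/wnorm_eq0 h; apply/eqP/val_inj.
have nr : normc ((real_complex R r)^-1) = r^-1.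
  by rewrite ComplexField.Normc.normcV /normc/= expr0n addr0 sqrtr_sqr gtr0_norm.
have Pl : P ((real_complex R r)^-1 *: v) = (real_complex R r)^-1 *: P xi.
  have := Lss_linear P (real_complex R r)^-1 v 0.
  have P00 : P 0 = 0.
    have := Lss_linear P 1 0 0; rewrite !scale1r addr0.
    by move=> /eqP; rewrite eq_sym -subr_eq0 addrK => /eqP.
  by rewrite P00 !addr0 Pv.
have n1 : ((normc ((real_complex R r)^-1))%:E * wnorm 0 (\val (P xi)))%E = 1%E.
  by rewrite nr rE -EFinM mulVf// gt_eqF.
have n2 : wnorm 0 ((real_complex R r)^-1 *: \val (P xi)) = 1%E.
  by rewrite wnormZ.
have := @opnorm_ub 0 P ((real_complex R r)^-1 *: v).
rewrite Pl -[\val (_ *: v)]/((real_complex R r)^-1 *: \val (P xi)).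
rewrite -[\val (_ *: P xi)]/((real_complex R r)^-1 *: \val (P xi)).
by rewrite n2; exact.
Qed.

End operators.

Arguments ev {R x} _ _.
Arguments evproj {R x} _ _.

Section Cs.
Variables (R : realType) (x : Lss R) (rho : spectral_repr x).

(* The value at z of a function on $\sigma(x)$; it is only of interest at 0 and
   at the eigenvalues, which are points of $\sigma(x)$.  The value 0 taken
   outside of $\sigma(x)$ is a dummy. *)
Definition val_at (f : spectrum x -> R[i]) (z : R[i]) : R[i] := 'valL_ 0 f z.

Definition Cs_norm (q : nat) (f : spectrum x -> R[i]) : \bar R :=
  ereal_sup (range (fun n =>
    ((normc (val_at f (ev rho n)))%:E * opnorm q (evproj rho n))%E)).

Definition Cs_pred : {pred spectrum x -> R[i]} :=
  [pred f | `[< val_at f 0 = 0 /\ forall q, (Cs_norm q f < +oo)%E >]].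

Lemma val_at_lin (a : R[i]) (f g : spectrum x -> R[i]) z :
  val_at (a *: f + g) z = a * val_at f z + val_at g z.
Proof.
rewrite /val_at/= oinv_set_val; case: insub => [t|]//=.
by rewrite mulr0 addr0.
Qed.

Lemma val_at0 z : val_at 0 z = 0.
Proof. by rewrite /val_at/= oinv_set_val; case: insub. Qed.

Lemma val_atM (f g : spectrum x -> R[i]) z :
  val_at (fun t => f t * g t) z = val_at f z * val_at g z.
Proof. by rewrite /val_at/= oinv_set_val; case: insub => [t|]//=; rewrite mulr0. Qed.

Lemma val_at_conj (f : spectrum x -> R[i]) z :
  val_at (fun t => conjc (f t)) z = conjc (val_at f z).
Proof. by rewrite /val_at/= oinv_set_val; case: insub => [t|]//; exact/esym/conjc0. Qed.

Lemma val_at_id z : val_at set_val z = z \/ val_at set_val z = 0.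
Proof.
rewrite /val_at/= oinv_set_val /=.
by case: insubP => [t _ tz|]; [left|right].
Qed.

Lemma Cs_norm_ub q (f : spectrum x -> R[i]) n :
  ((normc (val_at f (ev rho n)))%:E * opnorm q (evproj rho n) <= Cs_norm q f)%E.
Proof. by apply: ereal_sup_ubound; exists n. Qed.

Lemma Cs_norm_ge0 q (f : spectrum x -> R[i]) : (0 <= Cs_norm q f)%E.
Proof.
apply: le_trans (Cs_norm_ub _ _ 0%N).
by rewrite mule_ge0 ?opnorm_ge0// lee_fin normc_ge0.
Qed.

Lemma Cs_norm0 q : Cs_norm q 0 = 0%E.
Proof.
apply/eqP; rewrite eq_le Cs_norm_ge0 andbT; apply: ge_ereal_sup => _ [n _ <-].
by rewrite val_at0 ComplexField.Normc.normc0 mul0e.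
Qed.

Lemma Cs_norm_lin q a (f g : spectrum x -> R[i]) :
  (Cs_norm q (a *: f + g)%R <= (normc a)%:E * Cs_norm q f + Cs_norm q g)%E.
Proof.
apply: ge_ereal_sup => _ [n _ <-].
rewrite val_at_lin.
apply: (@le_trans _ _ ((normc a * normc (val_at f (ev rho n)) +
    normc (val_at g (ev rho n)))%:E * opnorm q (evproj rho n))%E).
  rewrite lee_wpmul2r ?opnorm_ge0// lee_fin.
  by rewrite (le_trans (le_normcD _ _))// ComplexField.Normc.normcM.
rewrite EFinD ge0_muleDl ?lee_fin ?mulr_ge0 ?normc_ge0//.
rewrite leeD ?Cs_norm_ub// EFinM -muleA.
by rewrite lee_wpmul2l ?lee_fin ?normc_ge0// Cs_norm_ub.
Qed.

Lemma Cs_submod_closed : submod_closed Cs_pred.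
Proof.
split.
  by apply/asboolP; split; [rewrite val_at0|move=> q; rewrite Cs_norm0].
move=> a f g /asboolP[f0 hf] /asboolP[g0 hg]; apply/asboolP; split.
  by rewrite val_at_lin f0 g0 mulr0 addr0.
move=> q; apply: le_lt_trans (Cs_norm_lin _ _ _ _) _.
by rewrite lte_add_pinfty// lte_mul_pinfty// lee_fin normc_ge0.
Qed.

HB.instance Definition _ :=
  GRing.isSubmodClosed.Build _ _ Cs_pred Cs_submod_closed.

Record Cs := MkCs { Csval :> spectrum x -> R[i]; _ : Csval \in Cs_pred }.

HB.instance Definition _ := [isSub for Csval].
HB.instance Definition _ := [Choice of Cs by <:].
HB.instance Definition _ := [SubChoice_isSubLmodule of Cs by <:].

Lemma CsP (f : Cs) : val_at f 0 = 0 /\ forall q, (Cs_norm q f < +oo)%E.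
Proof. by case: f => f /= /asboolP. Qed.

Definition Cs_seminorm q (f : Cs) := Cs_norm q (\val f).

Lemma Cs_seminorm0 q : Cs_seminorm q 0 = 0%E.
Proof. exact: Cs_norm0. Qed.

Lemma Cs_seminormD q (f g : Cs) :
  (Cs_seminorm q (f + g)%R <= Cs_seminorm q f + Cs_seminorm q g)%E.
Proof.
have := Cs_norm_lin q 1 f g.
by rewrite scale1r ComplexField.Normc.normc1 mul1e.
Qed.

HB.instance Definition _ := hasNbhs.Build Cs (seminorm_nbhs Cs_seminorm).

HB.instance Definition _ := Nbhs_isNbhsTopological.Build Cs
  (seminorm_nbhs_filter Cs_seminorm0)
  (seminorm_nbhs_singleton Cs_seminorm0)
  (seminorm_nbhs_nbhs Cs_seminormD).

Lemma Cs_mul_subproof (f g : Cs) : (fun t => f t * g t) \in Cs_pred.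
Proof.
have [f0 hf] := CsP f; have [g0 hg] := CsP g.
apply/asboolP; split; first by rewrite val_atM f0 mul0r.
move=> q; apply: (@le_lt_trans _ _ (Cs_norm 0 f * Cs_norm q g)%E); last first.
  by rewrite lte_mul_pinfty ?Cs_norm_ge0// ge0_fin_numE ?Cs_norm_ge0.
apply: ge_ereal_sup => _ [n _ <-].
rewrite val_atM ComplexField.Normc.normcM EFinM -muleA.
apply: lee_pmul; rewrite ?mule_ge0 ?opnorm_ge0 ?lee_fin ?normc_ge0//.
  apply: le_trans (Cs_norm_ub 0 f n).
  rewrite -[leLHS]mule1 lee_wpmul2l ?lee_fin ?normc_ge0//.
  by apply: opnorm_projection; [exact: evproj_neq0|case: (evproj_projection rho n)].
exact: Cs_norm_ub.
Qed.

Lemma Cs_conj_subproof (f : Cs) : (fun t => conjc (f t)) \in Cs_pred.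
Proof.
have [f0 hf] := CsP f.
apply/asboolP; split; first by rewrite val_at_conj f0 conjc0.
move=> q; apply: le_lt_trans (hf q); apply: ge_ereal_sup => _ [n _ <-].
apply: le_trans (Cs_norm_ub q f n); rewrite val_at_conj.
suff -> : normc (conjc (val_at f (ev rho n))) = normc (val_at f (ev rho n)) by [].
by case: (val_at _ _) => a b /=; rewrite sqrrN.
Qed.

Lemma Cs_id_subproof : (set_val : spectrum x -> R[i]) \in Cs_pred.
Proof.
apply/asboolP; split; first by case: (val_at_id 0).
move=> q; apply: le_lt_trans (spectral_abs_cvg rho q).
apply: ge_ereal_sup => _ [n _ <-].
apply: (@le_trans _ _ (opnorm q (ev rho n *: evproj rho n))).
  case: (val_at_id (ev rho n)) => ->; first by rewrite opnormZ.
  by rewrite ComplexField.Normc.normc0 mul0e opnorm_ge0.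
rewrite (@nneseriesD1 _ _ n)//; last by move=> *; exact: opnorm_ge0.
by rewrite leeDl// nneseries_ge0// => *; exact: opnorm_ge0.
Qed.

Definition Cs_mul (f g : Cs) : Cs := MkCs (Cs_mul_subproof f g).
Definition Cs_conj (f : Cs) : Cs := MkCs (Cs_conj_subproof f).
Definition Cs_id : Cs := MkCs Cs_id_subproof.

Definition frechet_algebra_iso (Phi : Cs -> alg x) :=
  [/\ linear (fun f => set_val (Phi f) : Lss R),
      forall f g, set_val (Phi (Cs_mul f g)) =
        Lmul (set_val (Phi f)) (set_val (Phi g)),
      continuous Phi &
      exists Psi : alg x -> Cs,
        [/\ cancel Phi Psi, cancel Psi Phi & continuous Psi]].

End Cs.

(* Main.v *)
(** For a projection P and an operator y with yP = aP, interpolation between the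
    norms |.|_q and self-adjointness of P give |a| ||P||_q^2 <= ||y||_(4q).  For
    y = f(x) and P = P_n this makes the inverse of the calculus continuous.  For
    y = P it gives ||P||_q^2 <= ||P||_(4q); since unit vectors w_n in the ranges of
    the P_n are orthonormal, 1 / ||P_n||_1 <= (|w_n|'_1)^2 and Bessel's inequality
    yield sum_n 1 / ||P_n||_1 <= sum_j j^(-2) <= 2.  Hence
    |f(lambda_n)| ||P_n||_q <= c_(4q+4)(f) / ||P_n||_1 is summable, and f(x) exists
    and depends continuously on f.  The P_n are limits of polynomials in x, so f(x)
    is in alg(x); conversely, y in the closure of {f(x)} satisfies y P_n = a_n P_n,
    and the first estimate shows that the a_n are the values of some f with
    y = f(x). *)
From HB Require Import structures.
Require Import Defs.
From mathcomp Require Import all_boot all_order all_algebra.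
From mathcomp Require Import all_classical all_reals all_analysis.
From mathcomp Require Import complex ring lra zify.

Set Implicit Arguments.
Unset Strict Implicit.
Unset Printing Implicit Defensive.

Import Order.TTheory GRing.Theory Num.Theory.
Import numFieldNormedType.Exports.

Local Open Scope classical_set_scope.
Local Open Scope ring_scope.

(** * Complex sequences and their weighted norms *)

(** A function in C_s only has |f(lambda_n)| ||P_n||_q bounded in n, while f(x) needs a summable
    majorant in every norm. The summable factor has to be gained by raising the index, and
    orthogonality of the P_n supplies it. The index 4q comes from interpolating twice. One
    interpolation, between 0 and 2q, gives |a| ||P||_q <= ||y||_(2q), which says nothing new for y =
    P. The second one, between 0 and 4q, improves the left side to |a| ||P||_q^2, and the square
    leaves room for the extra factor ||P_n||_1.

    The spectrum is defined by bounded inverses on l2, so it has to be proved that it contains every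
    lambda_n and nothing else except possibly 0. Until then the calculus is developed for
    coefficient sequences (a_n) in place of functions on the spectrum. *)

Section complex_modulus.
Variable R : realType.
Implicit Types (z w : R[i]) (u v : nat -> R[i]).

Lemma normcM z w : normc (z * w) = normc z * normc w.
Proof. exact: ComplexField.Normc.normcM. Qed.

Lemma normc_eq0 z : (normc z == 0) = (z == 0).
Proof.
by apply/eqP/eqP => [/ComplexField.Normc.eq0_normc//|->]; exact: ComplexField.Normc.normc0.
Qed.

Lemma normc_gt0 z : z != 0 -> 0 < normc z.
Proof. by move=> z0; rewrite lt_neqAle eq_sym normc_eq0 z0 normc_ge0. Qed.

Lemma normcV z : normc z^-1 = (normc z)^-1.
Proof. exact: ComplexField.Normc.normcV. Qed.

Lemma normc_opp z : normc (- z) = normc z.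
Proof. by case: z => a b /=; rewrite !sqrrN. Qed.

Lemma normc_distC z w : normc (z - w) = normc (w - z).
Proof. by rewrite -normc_opp opprB. Qed.

Lemma ler_normcD z w : normc (z + w) <= normc z + normc w.
Proof. exact: le_normcD. Qed.

Lemma ler_normcB_add z w y : normc (z - w) <= normc (z - y) + normc (y - w).
Proof. by rewrite -(subrKA y); exact: ler_normcD. Qed.

Lemma ler_dist_normc z w : `|normc z - normc w| <= normc (z - w).
Proof.
have h := ler_normcD (z - w) w; have k := ler_normcD (w - z) z.
rewrite !subrK (normc_distC w) in h k; rewrite ler_norml; apply/andP; split; lra.
Qed.

Lemma normc_conj z : normc (conjc z) = normc z.
Proof. by case: z => a b /=; rewrite sqrrN. Qed.

Lemma normc_real (r : R) : normc (real_complex R r) = `|r|.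
Proof. by rewrite /normc/= expr0n addr0 sqrtr_sqr. Qed.

Lemma mul_conjc z : z * conjc z = real_complex R (normc z ^+ 2).
Proof.
case: z => a b /=; rewrite sqr_sqrtr ?addr_ge0 ?sqr_ge0//.
by apply/eqP; rewrite eq_complex /=; apply/andP; split; apply/eqP; ring.
Qed.

Lemma ler_normc_sum (I : Type) (r : seq I) (P : pred I) (F : I -> R[i]) :
  normc (\sum_(i <- r | P i) F i) <= \sum_(i <- r | P i) normc (F i).
Proof.
elim/big_ind2 : _ => //; first by rewrite ComplexField.Normc.normc0.
by move=> z a w b za wb; apply: le_trans (ler_normcD _ _) (lerD _ _).
Qed.

Lemma Re_le_normc z : `|complex.Re z| <= normc z.
Proof.
by case: z => a b /=; rewrite -sqrtr_sqr ler_sqrt ?lerDl ?sqr_ge0 ?addr_ge0 ?sqr_ge0.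
Qed.

Lemma Im_le_normc z : `|complex.Im z| <= normc z.
Proof.
by case: z => a b /=; rewrite -sqrtr_sqr ler_sqrt ?lerDr ?sqr_ge0 ?addr_ge0 ?sqr_ge0.
Qed.

Lemma normc_le_ReIm z : normc z <= `|complex.Re z| + `|complex.Im z|.
Proof.
case: z => a b /=; rewrite -[leRHS]ger0_norm ?addr_ge0// -sqrtr_sqr ler_sqrt ?sqr_ge0//.
by rewrite sqrrD !real_normK ?num_real// -addrA lerD2l lerDr mulrn_wge0// mulr_ge0.
Qed.

(** The modulus [normc] takes values in R, unlike the norm of R[i]; hence the explicit epsilons. *)
Definition climit u z := forall e : R, 0 < e ->
  exists N, forall n, (N <= n)%N -> normc (u n - z) < e.

Lemma climit_unique u z w : climit u z -> climit u w -> z = w.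
Proof.
move=> uz uw; apply/eqP; rewrite -subr_eq0 -normc_eq0 eq_le normc_ge0 andbT.
apply/ler_addgt0Pr => e e0; rewrite add0r.
have e2 : 0 < e / 2 by rewrite divr_gt0.
have [N hN] := uz _ e2; have [M hM] := uw _ e2.
have := hN (maxn N M) (leq_maxl _ _); have := hM (maxn N M) (leq_maxr _ _).
have := ler_normcB_add z w (u (maxn N M)); rewrite (normc_distC z (u _)).
by move=> h1 h2 h3; lra.
Qed.

Lemma climitD u v z w : climit u z -> climit v w -> climit (fun n => u n + v n) (z + w).
Proof.
move=> uz vw e e0; have e2 : 0 < e / 2 by rewrite divr_gt0.
have [N hN] := uz _ e2; have [M hM] := vw _ e2.
exists (maxn N M) => n; rewrite geq_max => /andP[/hN h1 /hM h2].
rewrite opprD addrACA (le_lt_trans (ler_normcD _ _))//; lra.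
Qed.

Lemma climitZ (a : R[i]) u z : climit u z -> climit (fun n => a * u n) (a * z).
Proof.
move=> uz e e0.
have a1 : 0 < normc a + 1 by rewrite ltr_wpDl// normc_ge0.
have [N hN] := uz (e / (normc a + 1)) (divr_gt0 e0 a1).
exists N => n /hN h; rewrite -mulrBr normcM.
apply: (@le_lt_trans _ _ ((normc a + 1) * normc (u n - z))).
  by rewrite ler_wpM2r ?normc_ge0// lerDl.
by rewrite mulrC -ltr_pdivlMr.
Qed.

Lemma climit_conj u z : climit u z -> climit (fun n => conjc (u n)) (conjc z).
Proof. by move=> uz e /uz[N hN]; exists N => n /hN; rewrite -rmorphB normc_conj. Qed.

Lemma climit_normc_le u z (M : R) (N : nat) :
  (forall n, (N <= n)%N -> normc (u n) <= M) -> climit u z -> normc z <= M.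
Proof.
move=> uM uz; apply/ler_addgt0Pr => e /uz[K hK].
have := uM _ (leq_maxl N K); have := hK _ (leq_maxr N K).
have := ler_normcD (u (maxn N K)) (z - u (maxn N K)); rewrite addrC subrK.
rewrite (normc_distC z (u _)); lra.
Qed.

Definition csummable u := exists M : R, forall N, \sum_(j < N) normc (u j) <= M.

(** [csum] takes limits of the real and imaginary parts separately; both series converge absolutely
    because |Re z| and |Im z| are at most |z|. *)
Lemma csum_climit u : csummable u -> climit (fun n => \sum_(j < n) u j) (csum u).
Proof.
move=> [M hM].
have cv (f : nat -> R) : (forall j, `|f j| <= normc (u j)) ->
    forall e, 0 < e -> exists N, forall n, (N <= n)%N ->
      `|\sum_(j < n) f j - limn (series f)| < e.
  move=> fu e e0.
  have : cvgn (series f).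
    apply: normed_cvg; apply: nondecreasing_is_cvgn.
      by apply: nondecreasing_series => *; exact: normr_ge0.
    exists M => _ [n _ <-]; rewrite -[leLHS]/(\sum_(0 <= j < n) `|f j|) big_mkord.
    by apply: le_trans (hM n); apply: ler_sum => j _.
  move=> /cvgrPdist_lt /(_ e e0) [N _ hN].
  by exists N => n /hN; rewrite seriesEord/= distrC.
move=> e e0; have e2 : 0 < e / 2 by rewrite divr_gt0.
have [N hN] := cv (fun j => complex.Re (u j)) (fun j => Re_le_normc _) _ e2.
have [K hK] := cv (fun j => complex.Im (u j)) (fun j => Im_le_normc _) _ e2.
exists (maxn N K) => n; rewrite geq_max => /andP[/hN h1 /hK h2].
apply: le_lt_trans (normc_le_ReIm _) _.
rewrite !raddfB !raddf_sum [csum u]lock/= -lock /csum/=; lra.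
Qed.

End complex_modulus.

(** * Weighted norms through finite partial sums *)

Section weighted_norms.
Variable R : realType.
Implicit Types (k l m : int) (xi eta : nat -> R[i]).

Lemma sum_cauchy_schwarz (a b : nat -> R) (A B : R) n :
  (forall j, 0 <= a j) -> (forall j, 0 <= b j) -> 0 <= A -> 0 <= B ->
  \sum_(j < n) a j ^+ 2 <= A ^+ 2 -> \sum_(j < n) b j ^+ 2 <= B ^+ 2 ->
  \sum_(j < n) a j * b j <= A * B.
Proof.
move=> a0 b0 A0 B0 aA bB; set S := \sum_(_ < _) _ * _.
have S0 : 0 <= S by apply: sumr_ge0 => j _; rewrite mulr_ge0.
rewrite -(ler_pXn2r (n := 2))// ?nnegrE ?mulr_ge0// exprMn.
set al := \sum_(_ < _) _ in aA; set be := \sum_(_ < _) _ in bB.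
have al0 : 0 <= al by apply: sumr_ge0 => j _; exact: sqr_ge0.
have be0 : 0 <= be by apply: sumr_ge0 => j _; exact: sqr_ge0.
apply: (@le_trans _ _ (al * be)); last exact: ler_pM.
(* The sum equals [be * (al * be - S ^+ 2)]. Cancelling [be] requires [be > 0]; if [be = 0], all
   [b j] vanish and so does [S]. *)
have : 0 <= \sum_(j < n) (be * a j - S * b j) ^+ 2.
  by apply: sumr_ge0 => j _; exact: sqr_ge0.
have -> : \sum_(j < n) (be * a j - S * b j) ^+ 2 = be * (al * be - S ^+ 2).
  under eq_bigr => j _.
    have -> : (be * a j - S * b j) ^+ 2 =
      be ^+ 2 * a j ^+ 2 - 2 * be * S * (a j * b j) + S ^+ 2 * b j ^+ 2 by ring.
    over.
  rewrite big_split sumrB -!mulr_sumr -/al -/be -/S; rewrite /=; ring.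
have [be1|be1] := leP be 0; last by rewrite pmulr_rge0// subr_ge0.
have be_eq0 : be = 0 by apply/eqP; rewrite eq_le be1.
have b_eq0 : forall j : 'I_n, true -> b j ^+ 2 = 0.
  by apply: psumr_eq0P => // j _; exact: sqr_ge0.
rewrite /S big1 ?be_eq0 ?mulr0 ?expr0n// => j _.
by have /eqP := b_eq0 j isT; rewrite sqrf_eq0 => /eqP ->; rewrite mulr0.
Qed.

Definition wsum k n xi : R := \sum_(j < n) normc (xi j) ^+ 2 * j.+1%:R ^ (2 * k).

Definition rwnorm k xi : R := fine (wnorm k xi).

Definition wfin k xi := (wnorm k xi < +oo)%E.

Lemma wsum_term_ge0 k xi j : 0 <= normc (xi j) ^+ 2 * j.+1%:R ^ (2 * k) :> R.
Proof. by rewrite mulr_ge0 ?sqr_ge0 ?exprz_ge0. Qed.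

Lemma wsum_ge0 k n xi : 0 <= wsum k n xi.
Proof. by apply: sumr_ge0 => j _; exact: wsum_term_ge0. Qed.

Lemma wsumE k n xi : wsum k n xi = \sum_(j < n) (normc (xi j) * j.+1%:R ^ k) ^+ 2.
Proof.
apply: eq_bigr => j _; rewrite exprMn; congr (_ * _).
by rewrite [in RHS]exprnP exprz_exp mulrC.
Qed.

Lemma wsum_mono k n p xi : (n <= p)%N -> wsum k n xi <= wsum k p xi.
Proof.
move=> np; rewrite /wsum -(subnKC np) big_split_ord/= lerDl.
by apply: sumr_ge0 => j _; exact: wsum_term_ge0.
Qed.

(** The bridge from extended-valued norms to finite real sums, on which the estimates below are
    carried out. *)
Lemma wnorm_leP k xi (C : R) : 0 <= C ->
  (wnorm k xi <= C%:E)%E <-> forall n, wsum k n xi <= C ^+ 2.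
Proof.
move=> C0.
have t0 j : (0 <= (normc (xi j) ^+ 2 * j.+1%:R ^ (2 * k))%:E)%E.
  by rewrite lee_fin wsum_term_ge0.
set S := (\sum_(0 <= j <oo) (normc (xi j) ^+ 2 * j.+1%:R ^ (2 * k))%:E)%E.
have S0 : (0 <= S)%E by apply: nneseries_ge0.
have -> : (wnorm k xi <= C%:E)%E = (S <= (C ^+ 2)%:E)%E.
  rewrite -[RHS]lee_sqrt ?lee_fin ?sqr_ge0// EFin_expe sqrte_sqr gee0_abs//.
have wE n : (wsum k n xi)%:E =
    (\sum_(0 <= j < n) (normc (xi j) ^+ 2 * j.+1%:R ^ (2 * k))%:E)%E.
  by rewrite /wsum sumEFin big_mkord.
split=> [SC n|h].
  rewrite -lee_fin wE; apply: le_trans SC; exact: nneseries_lim_ge.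
apply: lime_le; first exact: is_cvg_nneseries.
by apply: nearW => n; rewrite -wE lee_fin.
Qed.

Lemma rwnorm_ge0 k xi : 0 <= rwnorm k xi.
Proof. by rewrite fine_ge0 ?wnorm_ge0. Qed.

Lemma rwnormE k xi : wfin k xi -> wnorm k xi = (rwnorm k xi)%:E.
Proof. by move=> h; rewrite fineK// ge0_fin_numE// wnorm_ge0. Qed.

Lemma wsum_le_rwnorm k xi n : wfin k xi -> wsum k n xi <= rwnorm k xi ^+ 2.
Proof. by move=> h; have [] := @wnorm_leP k xi _ (rwnorm_ge0 k xi); rewrite rwnormE// => ->. Qed.

Lemma wnorm_fin_le k xi (C : R) : (wnorm k xi <= C%:E)%E -> wfin k xi /\ rwnorm k xi <= C.
Proof.
move=> h; have f : wfin k xi by apply: le_lt_trans h (ltry _).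
by split=> //; rewrite -lee_fin -rwnormE.
Qed.

Lemma wsum_rwnorm_le k xi (C : R) : 0 <= C -> (forall n, wsum k n xi <= C ^+ 2) ->
  wfin k xi /\ rwnorm k xi <= C.
Proof. by move=> C0 /(wnorm_leP _ _ C0); exact: wnorm_fin_le. Qed.

Lemma wsum_approx k xi (e : R) : wfin k xi -> 0 < e ->
  exists N, rwnorm k xi ^+ 2 - e < wsum k N xi.
Proof.
move=> hx e0; apply: contrapT => /forallNP h.
have h' n : wsum k n xi <= rwnorm k xi ^+ 2 - e by rewrite leNgt; exact/negP.
have c0 : 0 <= rwnorm k xi ^+ 2 - e := le_trans (wsum_ge0 k 0 xi) (h' 0%N).
have [_] : wfin k xi /\ rwnorm k xi <= Num.sqrt (rwnorm k xi ^+ 2 - e).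
  apply: wsum_rwnorm_le; first exact: sqrtr_ge0.
  by move=> n; rewrite sqr_sqrtr.
rewrite leNgt => /negP; apply.
rewrite -[ltRHS](ger0_norm (rwnorm_ge0 k xi)) -sqrtr_sqr ltr_sqrt; first by lra.
by apply: lt_le_trans e0 _; rewrite -subr_ge0.
Qed.

Lemma wfin_le k l xi : k <= l -> wfin l xi -> wfin k xi.
Proof. by move=> kl; apply: le_lt_trans; exact: wnorm_le. Qed.

Lemma rwnorm_le k l xi : k <= l -> wfin l xi -> rwnorm k xi <= rwnorm l xi.
Proof.
move=> kl h; rewrite -lee_fin -!rwnormE//; first exact: wnorm_le.
exact: wfin_le h.
Qed.

Lemma wfinD k xi eta : wfin k xi -> wfin k eta -> wfin k (xi + eta).
Proof. by move=> h1 h2; have := wnorm_lin_lty 1 h1 h2; rewrite scale1r. Qed.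

Lemma wfinZ k a xi : wfin k xi -> wfin k (a *: xi).
Proof.
move=> h1; have := @wnorm_lin_lty _ k a xi 0 h1; rewrite addr0; apply.
by rewrite wnorm0.
Qed.

Lemma rwnormD k xi eta : wfin k xi -> wfin k eta ->
  rwnorm k (xi + eta) <= rwnorm k xi + rwnorm k eta.
Proof.
by move=> h1 h2; rewrite -lee_fin EFinD -!rwnormE ?wfinD//; exact: wnormD.
Qed.

Lemma rwnormZ k a xi : wfin k xi -> rwnorm k (a *: xi) = normc a * rwnorm k xi.
Proof. by move=> h; apply: EFin_inj; rewrite EFinM -!rwnormE ?wfinZ// wnormZ. Qed.

Lemma rwnorm0 k : rwnorm k 0 = 0.
Proof. by rewrite /rwnorm wnorm0. Qed.

Lemma wfin0 k : wfin k 0.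
Proof. by rewrite /wfin wnorm0. Qed.

Lemma rwnorm_eq0 k xi : wfin k xi -> rwnorm k xi = 0 -> xi = 0.
Proof. by move=> h h0; apply: (@wnorm_eq0 _ k); rewrite rwnormE// h0. Qed.

(** Cauchy-Schwarz for j^l |xi_j| and j^m |xi_j|, whose product is j^(2k) |xi_j|^2. *)
Lemma rwnorm_interpolation k l m xi : l + m = 2 * k -> wfin l xi -> wfin m xi ->
  wfin k xi /\ rwnorm k xi ^+ 2 <= rwnorm l xi * rwnorm m xi.
Proof.
move=> lm hl hm; have c0 : 0 <= rwnorm l xi * rwnorm m xi by rewrite mulr_ge0 ?rwnorm_ge0.
have := @wsum_rwnorm_le k xi _ (sqrtr_ge0 (rwnorm l xi * rwnorm m xi)); case.
  move=> n; rewrite sqr_sqrtr//.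
  rewrite (_ : wsum k n xi = \sum_(j < n)
      (normc (xi j) * j.+1%:R ^ l) * (normc (xi j) * j.+1%:R ^ m)).
    apply: (@sum_cauchy_schwarz (fun j => normc (xi j) * j.+1%:R ^ l)
       (fun j => normc (xi j) * j.+1%:R ^ m)); rewrite ?rwnorm_ge0 -?wsumE ?wsum_le_rwnorm//.
      by move=> j; rewrite mulr_ge0 ?normc_ge0 ?exprz_ge0.
    by move=> j; rewrite mulr_ge0 ?normc_ge0 ?exprz_ge0.
  apply: eq_bigr => j _; rewrite mulrACA -expr2 -lm expfzDr ?pnatr_eq0//.
move=> fk hk; split => //.
rewrite -[leRHS]sqr_sqrtr// ler_pXn2r// ?nnegrE ?rwnorm_ge0 ?sqrtr_ge0//.
Qed.

Lemma rwnorm_duality k xi eta n : wfin (- k) xi -> wfin k eta ->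
  \sum_(j < n) normc (xi j) * normc (eta j) <= rwnorm (- k) xi * rwnorm k eta.
Proof.
move=> hx he.
rewrite (_ : \sum_(j < n) _ = \sum_(j < n)
    (normc (xi j) * j.+1%:R ^ (- k)) * (normc (eta j) * j.+1%:R ^ k)).
  apply: (@sum_cauchy_schwarz (fun j => normc (xi j) * j.+1%:R ^ (- k))
     (fun j => normc (eta j) * j.+1%:R ^ k)); rewrite ?rwnorm_ge0 -?wsumE ?wsum_le_rwnorm//.
    by move=> j; rewrite mulr_ge0 ?normc_ge0 ?exprz_ge0.
  by move=> j; rewrite mulr_ge0 ?normc_ge0 ?exprz_ge0.
by apply: eq_bigr => j _; rewrite mulrACA -expfzDr ?pnatr_eq0// addNr expr0z mulr1.
Qed.

Lemma rwnorm_coord xi j : wfin 0 xi -> normc (xi j) <= rwnorm 0 xi.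
Proof.
move=> h; rewrite -(ler_pXn2r (n := 2))// ?nnegrE ?normc_ge0 ?rwnorm_ge0//.
apply: le_trans (wsum_le_rwnorm j.+1 h); rewrite /wsum big_ord_recr/= mulr0 expr0z mulr1.
by rewrite lerDr; apply: sumr_ge0 => i _; rewrite mulr_ge0 ?sqr_ge0.
Qed.

(** A Fatou property: each [wsum k n] involves finitely many coordinates, so its bound passes to the
    coordinatewise limit. *)
Lemma rwnorm_liminf k (u : nat -> nat -> R[i]) xi (C : R) N : 0 <= C ->
  (forall j, climit (fun n => u n j) (xi j)) ->
  (forall n, (N <= n)%N -> (wnorm k (u n) <= C%:E)%E) -> (wnorm k xi <= C%:E)%E.
Proof.
move=> C0 uxi uC; apply/wnorm_leP => // n.
have cv : (fun p => wsum k n (u p)) @ \oo --> wsum k n xi.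
  rewrite /wsum; apply: cvg_big => [|j _]; first exact: add_continuous.
  apply: cvgMr_tmp; rewrite !expr2.
  suff h : (fun p => normc (u p j)) @ \oo --> normc (xi j) by apply: cvgM.
  apply/cvgrPdist_lt => e /(uxi j)[M hM]; exists M => // p /hM.
  by apply: le_lt_trans; rewrite distrC ler_dist_normc.
rewrite -(cvg_lim _ cv)//; apply: limr_le; first by apply/cvg_ex; eexists; exact: cv.
by exists N => // p /uC /wnorm_leP; exact.
Qed.

Definition trunc N xi : nat -> R[i] := fun j => if (j < N)%N then xi j else 0.

Lemma trunc_wfin k N xi : wfin k (trunc N xi).
Proof.
have [] // := @wsum_rwnorm_le k (trunc N xi) _ (sqrtr_ge0 (wsum k N xi)).
move=> n; rewrite sqr_sqrtr ?wsum_ge0//.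
apply: le_trans (wsum_mono k xi (geq_minr n N)).
rewrite /wsum [leRHS](big_ord_widen n
  (fun j => normc (xi j) ^+ 2 * j.+1%:R ^ (2 * k))); last exact: geq_minl.
rewrite [leRHS]big_mkcond/=; apply: ler_sum => j _; rewrite /trunc leq_min ltn_ord/=.
by case: ifP => // _; rewrite ComplexField.Normc.normc0 expr0n mul0r.
Qed.

Lemma trunc_approx k xi (e : R) : wfin k xi -> 0 < e ->
  exists N, (wnorm k (xi - trunc N xi)%R <= e%:E)%E.
Proof.
move=> hx e0; pose A := range (fun n => wsum k n xi).
have supA : has_sup A.
  split; first by exists (wsum k 0 xi), 0%N.
  by exists (rwnorm k xi ^+ 2) => _ [n _ <-]; exact: wsum_le_rwnorm.
have e2 : 0 < e ^+ 2 by rewrite exprn_gt0.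
have [_ [N _ <-] hN] := sup_adherent e2 supA.
exists N; apply/wnorm_leP; first exact: ltW.
move=> n; have np := leq_maxl n N; have Np := leq_maxr n N.
apply: le_trans (wsum_mono _ _ np) _; set p := maxn n N in np Np *.
have : wsum k p (xi - trunc N xi) = wsum k p xi - wsum k N xi.
  rewrite /wsum [X in _ = _ - X](big_ord_widen p
    (fun j => normc (xi j) ^+ 2 * j.+1%:R ^ (2 * k)))//.
  rewrite [X in _ = _ - X]big_mkcond/= -sumrB; apply: eq_bigr => j _.
  rewrite -[(xi - trunc N xi) j]/(xi j - trunc N xi j) /trunc.
  case: ifP => _; last by rewrite !subr0.
  by rewrite !subrr ComplexField.Normc.normc0 expr0n mul0r.
move=> ->; have : wsum k p xi <= sup A by apply: sup_upper_bound => //; exists p.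
lra.
Qed.

End weighted_norms.

(** * The inner product as a pairing of weighted spaces *)

Section inner_product.
Variable R : realType.
Implicit Types (k : int) (xi eta zeta : nat -> R[i]).

(** On elements of l2 this is [l2inner] by conversion. Being defined on bare sequences, it also
    pairs sequences of finite norm |.|'_q with those of finite norm |.|_q. *)
Definition cinner xi eta : R[i] := csum (fun j => xi j * conjc (eta j)).

Lemma cinner_partial_le k xi eta n : wfin (- k) xi -> wfin k eta ->
  \sum_(j < n) normc (xi j * conjc (eta j)) <= rwnorm (- k) xi * rwnorm k eta.
Proof.
move=> hx he; apply: le_trans (rwnorm_duality n hx he).
by apply: ler_sum => j _; rewrite normcM normc_conj.
Qed.

Lemma cinner_climit k xi eta : wfin (- k) xi -> wfin k eta ->
  climit (fun n => \sum_(j < n) xi j * conjc (eta j)) (cinner xi eta).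
Proof.
move=> hx he; apply: csum_climit; exists (rwnorm (- k) xi * rwnorm k eta) => n.
exact: cinner_partial_le.
Qed.

Lemma cinner_le k xi eta : wfin (- k) xi -> wfin k eta ->
  normc (cinner xi eta) <= rwnorm (- k) xi * rwnorm k eta.
Proof.
move=> hx he; apply: (@climit_normc_le _ _ _ _ 0%N _ (cinner_climit hx he)).
move=> n _; apply: le_trans (ler_normc_sum _ _ _) _; exact: cinner_partial_le.
Qed.

Lemma cinnerC xi eta : wfin 0 xi -> wfin 0 eta ->
  cinner eta xi = conjc (cinner xi eta).
Proof.
move=> hx he; apply: climit_unique (@cinner_climit 0 _ _ _ _) _ => //.
have := climit_conj (@cinner_climit 0 _ _ hx he).
congr climit; apply/funext => n; rewrite raddf_sum; apply: eq_bigr => j _ /=.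
by rewrite rmorphM /= conjcK mulrC.
Qed.

Lemma cinnerDl xi eta zeta : wfin 0 xi -> wfin 0 eta -> wfin 0 zeta ->
  cinner (xi + eta) zeta = cinner xi zeta + cinner eta zeta.
Proof.
move=> hx he hz.
apply: climit_unique (@cinner_climit 0 _ _ _ _) _ => //; first exact: wfinD.
have := climitD (@cinner_climit 0 _ _ hx hz) (@cinner_climit 0 _ _ he hz).
congr climit; apply/funext => n; rewrite -big_split; apply: eq_bigr => j _ /=.
by rewrite -mulrDl.
Qed.

Lemma cinnerZl a xi zeta : wfin 0 xi -> wfin 0 zeta ->
  cinner (a *: xi) zeta = a * cinner xi zeta.
Proof.
move=> hx hz.
apply: climit_unique (@cinner_climit 0 _ _ _ _) _ => //; first exact: wfinZ.
have := climitZ a (@cinner_climit 0 _ _ hx hz).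
congr climit; apply/funext => n; rewrite mulr_sumr; apply: eq_bigr => j _ /=.
by rewrite mulrA.
Qed.

Lemma cinnerDr xi eta zeta : wfin 0 xi -> wfin 0 eta -> wfin 0 zeta ->
  cinner zeta (xi + eta) = cinner zeta xi + cinner zeta eta.
Proof.
move=> hx he hz; rewrite cinnerC//; last exact: wfinD.
by rewrite cinnerDl// (cinnerC hx hz) (cinnerC he hz) -rmorphD.
Qed.

Lemma cinnerZr a xi zeta : wfin 0 xi -> wfin 0 zeta ->
  cinner zeta (a *: xi) = conjc a * cinner zeta xi.
Proof.
move=> hx hz; rewrite cinnerC//; last exact: wfinZ.
by rewrite cinnerZl// (cinnerC hx hz) -rmorphM.
Qed.

Lemma cinner0l zeta : cinner 0 zeta = 0.
Proof.
rewrite /cinner; apply: (@climit_unique _ (fun=> 0)); last first.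
  by move=> e e0; exists 0%N => n _; rewrite subrr ComplexField.Normc.normc0.
(* [zeta] is an arbitrary sequence, so convergence is borrowed from the pairing of 0 with 0, which
   has the same terms. *)
have := @cinner_climit 0 0 0 (@wfin0 _ _) (@wfin0 _ _).
rewrite /cinner (_ : (fun j => (0 : nat -> R[i]) j * conjc (zeta j)) =
  (fun j => (0 : nat -> R[i]) j * conjc ((0 : nat -> R[i]) j))); last first.
  by apply/funext => j; rewrite !mul0r.
by congr climit; apply/funext => n; rewrite big1// => j _; rewrite mul0r.
Qed.

Lemma cinner_self xi : wfin 0 xi -> cinner xi xi = ((rwnorm 0 xi ^+ 2)%:C)%C.
Proof.
move=> hx; apply: climit_unique (@cinner_climit 0 _ _ hx hx) _ => e e0.
have wE n : \sum_(j < n) xi j * conjc (xi j) = ((wsum 0 n xi)%:C)%C.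
  rewrite /wsum rmorph_sum; apply: eq_bigr => j _.
  by rewrite mul_conjc mulr0 expr0z mulr1.
have [N hN] := wsum_approx hx e0.
exists N => n /(wsum_mono 0 xi) Nn.
rewrite wE -rmorphB normc_real ler0_norm ?subr_le0 ?wsum_le_rwnorm//.
rewrite opprB; lra.
Qed.

End inner_product.

Section sequence_space_elements.
Variable R : realType.

Lemma s_wfin k (u : sspace R) : wfin k u.
Proof.
have /asboolP h : Defs.sval u \in @s_pred R by case: u.
by apply: (@wfin_le _ _ `|k|%N); [rewrite abszE; exact: ler_norm|exact: h].
Qed.

Lemma s_valD (u v : sspace R) : Defs.sval (u + v) = Defs.sval u + Defs.sval v.
Proof. by []. Qed.

Lemma s_valZ a (u : sspace R) : Defs.sval (a *: u) = a *: Defs.sval u.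
Proof. by []. Qed.

Lemma s_rwnormD k (u v : sspace R) : rwnorm k (u + v) <= rwnorm k u + rwnorm k v.
Proof. by rewrite s_valD; apply: rwnormD; exact: s_wfin. Qed.

Lemma s_rwnormZ k a (u : sspace R) : rwnorm k (a *: u) = normc a * rwnorm k u.
Proof. by rewrite s_valZ; apply: rwnormZ; exact: s_wfin. Qed.

Lemma l2_wfin (u : l2space R) : wfin 0 u.
Proof. by have /asboolP : l2val u \in @l2_pred R by case: u. Qed.

Lemma l2_wfinN (q : nat) (u : l2space R) : wfin (- q%:Z) u.
Proof. by apply: wfin_le (l2_wfin u); rewrite oppr_le0. Qed.

Lemma sdual_wfin (u : sdual R) : exists q : nat, forall r : nat, (q <= r)%N -> wfin (- r%:Z) u.
Proof.
have /asboolP[q h] : sdualval u \in @sdual_pred R by case: u.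
exists q => r qr; apply: wfin_le h; lia.
Qed.

End sequence_space_elements.

(** * The Frechet algebra L(s', s) *)

Section operator_norms.
Variable R : realType.
Implicit Types (x y z : Lss R) (u v : sdual R) (q : nat).

HB.instance Definition _ y := GRing.isLinear.Build _ _ _ _ y (@Lss_linear R y).

Lemma LssDE y z u : (y + z) u = y u + z u. Proof. by []. Qed.
Lemma LssZE a y u : (a *: y) u = a *: y u. Proof. by []. Qed.
Lemma LssNE y u : (- y) u = - y u. Proof. by []. Qed.
Lemma LssE_sum (I : Type) (r : seq I) (F : I -> Lss R) u :
  (\sum_(i <- r) F i) u = \sum_(i <- r) F i u.
Proof. by elim/big_rec2 : _ => // i a b _ <-. Qed.
Lemma LmulE y z u : Lmul y z u = y (s_to_sdual (z u)). Proof. by []. Qed.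

Lemma Lss_eq y z : (forall u, y u = z u) -> y = z.
Proof. by move=> h; apply/val_inj/funext. Qed.

Lemma Lss_map0 y : y 0 = 0. Proof. exact: linear0. Qed.
Lemma Lss_mapD y u v : y (u + v) = y u + y v. Proof. exact: linearD. Qed.
Lemma Lss_mapZ y a u : y (a *: u) = a *: y u. Proof. exact: linearZ. Qed.
Lemma Lss_mapB y u v : y (u - v) = y u - y v. Proof. exact: linearB. Qed.

(** The preimage of a unit ball of s contains an absolutely convex V that contains the open e-ball
    of s'_q. For |u|'_q <= 1 the vector (e/2) u lies in that open ball, whence the bound 2/e. *)
Lemma opnorm_lty q y : (opnorm q y < +oo)%E.
Proof.
have := @Lss_continuous R y 0 [set w : sspace R | forall k, (k <= q)%N ->
  (wnorm k (\val (w - y 0)%R) < 1%:E)%E].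
case; first by exists q, 1; split.
move=> V [_ nV hV]; have [e e0 he] := nV q.
have e20 : 0 < e / 2 by rewrite divr_gt0.
suff : (opnorm q y <= (2 / e)%:E)%E by move=> h; apply: le_lt_trans h (ltry _).
apply: ge_ereal_sup => _ [u /= u1 <-].
have := hV (((e / 2)%:C)%C *: u); rewrite add0r => h.
have /h/(_ q (leqnn q)) : V (((e / 2)%:C)%C *: u).
  apply: he; rewrite /= wnormZ normc_real ger0_norm ?(ltW e20)//.
  apply: (@le_lt_trans _ _ ((e / 2)%:E * 1)%E).
    by rewrite lee_wpmul2l// lee_fin ltW.
  by rewrite mule1 lte_fin ltr_pdivrMr// ltr_pMr// ltr1n.
rewrite Lss_map0 subr0 Lss_mapZ wnormZ normc_real ger0_norm ?(ltW e20)// => /ltW.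
by rewrite -lee_pdivlMl// invf_div mule1.
Qed.

Definition ropnorm q y : R := fine (opnorm q y).

Lemma ropnormE q y : opnorm q y = (ropnorm q y)%:E.
Proof. by rewrite fineK// ge0_fin_numE ?opnorm_ge0// opnorm_lty. Qed.

Lemma ropnorm_ge0 q y : 0 <= ropnorm q y.
Proof. by rewrite fine_ge0// opnorm_ge0. Qed.

Lemma ropnorm_ub q y u : wfin (- q%:Z) u -> rwnorm q (y u) <= ropnorm q y * rwnorm (- q%:Z) u.
Proof.
move=> fu; have [r0|r0] := eqVneq (rwnorm (- q%:Z) u) 0.
  have -> : u = 0 by apply/val_inj; exact: rwnorm_eq0 r0.
  by rewrite Lss_map0 !rwnorm0 mulr0.
have rp : 0 < rwnorm (- q%:Z) u by rewrite lt_neqAle eq_sym r0 rwnorm_ge0.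
set r := rwnorm (- q%:Z) u in r0 rp *.
have := @opnorm_ub R q y (((r^-1)%:C)%C *: u).
rewrite Lss_mapZ !wnormZ normc_real ger0_norm ?invr_ge0 ?(ltW rp)//.
rewrite ropnormE !rwnormE//; last exact: s_wfin.
rewrite -!EFinM !lee_fin -/r mulVf// lexx => /(_ isT).
by rewrite ler_pdivrMl// mulrC.
Qed.

Lemma ropnorm_ub_s q y (w : sspace R) :
  rwnorm q (y (s_to_sdual w)) <= ropnorm q y * rwnorm (- q%:Z) w.
Proof. by have := @ropnorm_ub q y (s_to_sdual w) (s_wfin (- q%:Z) w). Qed.

Lemma ropnorm_ub_l2 q y (w : l2space R) :
  rwnorm q (y (l2_to_sdual w)) <= ropnorm q y * rwnorm (- q%:Z) w.
Proof. by have := @ropnorm_ub q y (l2_to_sdual w) (l2_wfinN q w). Qed.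

Lemma ropnorm_le q y (C : R) : 0 <= C ->
  (forall u, wfin (- q%:Z) u -> rwnorm q (y u) <= C * rwnorm (- q%:Z) u) -> ropnorm q y <= C.
Proof.
move=> C0 h; rewrite -lee_fin -ropnormE; apply: ge_ereal_sup => _ [u /= u1 <-].
have fu : wfin (- q%:Z) u by apply: le_lt_trans u1 (ltry _).
rewrite rwnormE ?s_wfin// lee_fin; apply: le_trans (h u fu) _.
by rewrite -[leRHS]mulr1 ler_wpM2l// -lee_fin -rwnormE.
Qed.

(** Raising q enlarges both the unit ball of |.|'_q in the source and the norm |.|_q in the
    target. *)
Lemma ropnorm_mono q r y : (q <= r)%N -> ropnorm q y <= ropnorm r y.
Proof.
move=> qr; apply: ropnorm_le; first exact: ropnorm_ge0.
move=> u fu; apply: le_trans (rwnorm_le _ (s_wfin r (y u))) _; first lia.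
have nr : - r%:Z <= - q%:Z by lia.
apply: le_trans (ropnorm_ub _ (wfin_le nr fu)) _.
by rewrite ler_wpM2l ?ropnorm_ge0// rwnorm_le.
Qed.

Lemma ropnormD q y z : ropnorm q (y + z) <= ropnorm q y + ropnorm q z.
Proof. by rewrite -lee_fin EFinD -!ropnormE; exact: opnormD. Qed.

Lemma ropnormZ q a y : ropnorm q (a *: y) = normc a * ropnorm q y.
Proof. by apply: EFin_inj; rewrite EFinM -!ropnormE opnormZ. Qed.

Lemma ropnormN q y : ropnorm q (- y) = ropnorm q y.
Proof. by rewrite -scaleN1r ropnormZ normc_opp ComplexField.Normc.normc1 mul1r. Qed.

Lemma ropnorm_distC q y z : ropnorm q (y - z) = ropnorm q (z - y).
Proof. by rewrite -ropnormN opprB. Qed.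

Lemma ropnormB_add q y z w : ropnorm q (y - z) <= ropnorm q (y - w) + ropnorm q (w - z).
Proof. by rewrite -(subrKA w); exact: ropnormD. Qed.

Lemma ropnorm0 q : ropnorm q 0 = 0.
Proof. by rewrite /ropnorm opnorm0. Qed.

Lemma ropnorm_sum q (I : Type) (r : seq I) (F : I -> Lss R) :
  ropnorm q (\sum_(i <- r) F i) <= \sum_(i <- r) ropnorm q (F i).
Proof.
elim/big_ind2 : _ => //; first by rewrite ropnorm0.
by move=> a y b z ya zb; exact: le_trans (ropnormD q y z) (lerD ya zb).
Qed.

(** Between the two factors |.|'_q is bounded by |.|_q, as all weights are at least 1. *)
Lemma ropnormM q y z : ropnorm q (Lmul y z) <= ropnorm q y * ropnorm q z.
Proof.
apply: ropnorm_le; first by rewrite mulr_ge0 ?ropnorm_ge0.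
move=> u fu; rewrite LmulE.
apply: le_trans (ropnorm_ub_s q y (z u)) _.
rewrite -mulrA ler_wpM2l ?ropnorm_ge0//; apply: le_trans (ropnorm_ub z fu).
by apply: rwnorm_le (s_wfin _ _); lia.
Qed.

Lemma ropnorm_eq0 y : (forall q, ropnorm q y = 0) -> y = 0.
Proof.
move=> h; apply: Lss_eq => u; have [q /(_ q (leqnn q)) fu] := sdual_wfin u.
apply/val_inj; apply: (@rwnorm_eq0 _ q); first exact: s_wfin.
by apply/eqP; rewrite eq_le rwnorm_ge0 andbT; have := ropnorm_ub y fu; rewrite h mul0r.
Qed.

Lemma sdual_trunc_subproof N (u : nat -> R[i]) : trunc N u \in @l2_pred R.
Proof. by apply/asboolP; exact: trunc_wfin. Qed.

Definition l2trunc N u : l2space R := L2Space (sdual_trunc_subproof N u).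

(* The truncations of an element of [s'_q] converge to it in [s'_q], hence
   $\ell_2$ is dense in $s'_q$. *)
Lemma ropnorm_le_l2 q y (C : R) : 0 <= C ->
  (forall u : l2space R, rwnorm q (y (l2_to_sdual u)) <= C * rwnorm (- q%:Z) u) ->
  ropnorm q y <= C.
Proof.
move=> C0 h; apply: ropnorm_le => // u fu; apply/ler_addgt0Pr => e e0.
(* A truncation at distance at most d = e / K from [u] costs at most (||y||_q + C) d; the summand 1
   keeps K positive. *)
have K0 : 0 < ropnorm q y + C + 1 by rewrite ltr_wpDl ?addr_ge0 ?ropnorm_ge0.
have [N /wnorm_fin_le[fd hN]] := trunc_approx fu (divr_gt0 e0 K0).
set d : R := e / _ in hN.
pose t := l2_to_sdual (l2trunc N u).
have d0 := rwnorm_ge0 (- q%:Z) (sdualval u - trunc N u).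
have ft : wfin (- q%:Z) t by exact: trunc_wfin.
have hy : rwnorm q (y u) <= rwnorm q (y t) + rwnorm q (y (u - t)).
  have -> : y u = y t + y (u - t) by rewrite -Lss_mapD addrC subrK.
  exact: s_rwnormD.
have h1 : rwnorm q (y (u - t)) <= ropnorm q y * d.
  have := @ropnorm_ub q y (u - t) fd => /le_trans; apply.
  by apply: ler_wpM2l; [exact: ropnorm_ge0|exact: hN].
have h2 : rwnorm q (y t) <= C * (rwnorm (- q%:Z) u + d).
  apply: le_trans (h (l2trunc N u)) _; apply: ler_wpM2l => //.
  have -> : l2val (l2trunc N u) = sdualval u + (- 1) *: (sdualval u - trunc N u).
    by rewrite scaleN1r subKr.
  apply: le_trans (rwnormD fu (wfinZ _ fd)) _; rewrite lerD2l rwnormZ//.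
  by rewrite normc_opp ComplexField.Normc.normc1 mul1r.
have e0' : ropnorm q y * d + C * d <= e.
  rewrite -mulrDl /d mulrCA ger_pMr// ler_pdivrMr// mul1r; lra.
rewrite mulrDr in h2; lra.
Qed.

End operator_norms.

(** * Convergence, products and completeness in L(s', s) *)

Section operator_limits.
Variable R : realType.
Implicit Types (y z l : Lss R) (u v : nat -> Lss R) (q : nat).

Lemma add_lt_halves (a b c e : R) : a <= b + c -> b < e / 2 -> c < e / 2 -> a < e.
Proof. by move=> h b2 c2; apply: le_lt_trans h _; rewrite [e]splitr; exact: ltrD. Qed.

Definition Lcvg u l := forall q (e : R), 0 < e ->
  exists N, forall n, (N <= n)%N -> ropnorm q (u n - l) < e.

Lemma LcvgP u l : u @ \oo --> l <-> Lcvg u l.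
Proof.
split=> [ul q e e0|ul A [q [e [e0 h]]]].
  have /ul[N _ hN] : nbhs l [set y | forall k, (k <= q)%N -> (opnorm k (y - l)%R < e%:E)%E].
    by exists q, e; split.
  by exists N => n /hN/(_ q (leqnn q)); rewrite ropnormE lte_fin.
have [N hN] := ul q e e0; exists N => // n /hN hn; apply: h => k kq.
by rewrite ropnormE lte_fin; apply: le_lt_trans (ropnorm_mono _ kq) hn.
Qed.

Lemma Lcvg_unique u y z : Lcvg u y -> Lcvg u z -> y = z.
Proof.
move=> uy uz; apply: subr0_eq; apply: ropnorm_eq0 => q.
apply/eqP; rewrite eq_le ropnorm_ge0 andbT; apply/ler_addgt0Pr => e e0; rewrite add0r.
have e2 : 0 < e / 2 by rewrite divr_gt0.
have [N hN] := uy q _ e2; have [M hM] := uz q _ e2.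
have h1 := hN (maxn N M) (leq_maxl _ _); have h2 := hM (maxn N M) (leq_maxr _ _).
by apply/ltW/(add_lt_halves (ropnormB_add q y z (u (maxn N M)))) => //; rewrite ropnorm_distC.
Qed.

Lemma LcvgD u v y z : Lcvg u y -> Lcvg v z -> Lcvg (fun n => u n + v n) (y + z).
Proof.
move=> uy vz q e e0; have e2 : 0 < e / 2 by rewrite divr_gt0.
have [N hN] := uy q _ e2; have [M hM] := vz q _ e2.
exists (maxn N M) => n; rewrite geq_max => /andP[/hN h1 /hM h2].
rewrite opprD addrACA; exact: add_lt_halves (ropnormD q (u n - y) (v n - z)) h1 h2.
Qed.

Lemma Lcvg_bound u y (K : R) v z : 0 <= K -> Lcvg u y ->
  (forall q n, ropnorm q (v n - z) <= K * ropnorm q (u n - y)) -> Lcvg v z.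
Proof.
move=> K0 uy h q e e0.
have K1 : 0 < K + 1 by rewrite ltr_wpDl.
have [N hN] := uy q _ (divr_gt0 e0 K1).
exists N => n /hN hn; apply: le_lt_trans (h q n) _.
apply: (@le_lt_trans _ _ ((K + 1) * ropnorm q (u n - y))).
  by rewrite ler_wpM2r ?ropnorm_ge0// lerDl.
by rewrite mulrC -ltr_pdivlMr.
Qed.

Lemma LcvgZ a u y : Lcvg u y -> Lcvg (fun n => a *: u n) (a *: y).
Proof.
move=> uy; apply: (Lcvg_bound (normc_ge0 a) uy) => q n.
by rewrite -scalerBr ropnormZ.
Qed.

Lemma LmulBr y z w : Lmul y (z - w) = Lmul y z - Lmul y w.
Proof.
apply: Lss_eq => u; rewrite LmulE -[RHS]/(Lmul y z u - Lmul y w u) !LmulE -Lss_mapB.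
by congr (y _); exact: val_inj.
Qed.

Lemma LmulBl y z w : Lmul (z - w) y = Lmul z y - Lmul w y.
Proof. by apply: Lss_eq. Qed.

Lemma LmulDr y z w : Lmul y (z + w) = Lmul y z + Lmul y w.
Proof.
apply: Lss_eq => u; rewrite LmulE -[RHS]/(Lmul y z u + Lmul y w u) !LmulE -Lss_mapD.
by congr (y _); exact: val_inj.
Qed.

Lemma LmulDl y z w : Lmul (z + w) y = Lmul z y + Lmul w y.
Proof. by apply: Lss_eq. Qed.

Lemma LmulZl a y z : Lmul (a *: y) z = a *: Lmul y z.
Proof. by apply: Lss_eq. Qed.

Lemma LmulZr a y z : Lmul y (a *: z) = a *: Lmul y z.
Proof.
apply: Lss_eq => u; rewrite LmulE -[RHS]/(a *: Lmul y z u) !LmulE -Lss_mapZ.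
by congr (y _); exact: val_inj.
Qed.

Lemma Lmul0l y : Lmul 0 y = 0. Proof. by apply: Lss_eq. Qed.

Lemma Lmul0r y : Lmul y 0 = 0.
Proof. by rewrite -(subrr y) LmulBr !subrr. Qed.

Lemma Lmul_suml (I : Type) (r : seq I) (F : I -> Lss R) y :
  Lmul (\sum_(i <- r) F i) y = \sum_(i <- r) Lmul (F i) y.
Proof. by elim/big_rec2 : _ => [|i a b _ <-]; [exact: Lmul0l|exact: LmulDl]. Qed.

Lemma Lmul_sumr (I : Type) (r : seq I) (F : I -> Lss R) y :
  Lmul y (\sum_(i <- r) F i) = \sum_(i <- r) Lmul y (F i).
Proof. by elim/big_rec2 : _ => [|i a b _ <-]; [exact: Lmul0r|exact: LmulDr]. Qed.

Lemma Lcvg_Lmull z u y : Lcvg u y -> Lcvg (fun n => Lmul z (u n)) (Lmul z y).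
Proof.
move=> uy q e e0.
have K1 : 0 < ropnorm q z + 1 by rewrite ltr_wpDl ?ropnorm_ge0.
have [N hN] := uy q _ (divr_gt0 e0 K1).
exists N => n /hN hn; rewrite -LmulBr; apply: le_lt_trans (ropnormM _ _ _) _.
apply: (@le_lt_trans _ _ ((ropnorm q z + 1) * ropnorm q (u n - y))).
  by rewrite ler_wpM2r ?ropnorm_ge0// lerDl.
by rewrite mulrC -ltr_pdivlMr.
Qed.

Lemma Lcvg_Lmulr z u y : Lcvg u y -> Lcvg (fun n => Lmul (u n) z) (Lmul y z).
Proof.
move=> uy q e e0.
have K1 : 0 < ropnorm q z + 1 by rewrite ltr_wpDl ?ropnorm_ge0.
have [N hN] := uy q _ (divr_gt0 e0 K1).
exists N => n /hN hn; rewrite -LmulBl; apply: le_lt_trans (ropnormM _ _ _) _.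
apply: (@le_lt_trans _ _ (ropnorm q (u n - y) * (ropnorm q z + 1))).
  by rewrite ler_wpM2l ?ropnorm_ge0// lerDl.
by rewrite -ltr_pdivlMr.
Qed.

Lemma Lcvg_ropnorm_le q u y (C : R) N :
  (forall n, (N <= n)%N -> ropnorm q (u n) <= C) -> Lcvg u y -> ropnorm q y <= C.
Proof.
move=> uC uy; apply/ler_addgt0Pr => e /(uy q)[K hK].
have h1 := uC _ (leq_maxl N K); have h2 := hK _ (leq_maxr N K).
have -> : y = u (maxn N K) - (u (maxn N K) - y) by rewrite subKr.
apply: le_trans (ropnormD _ _ _) _; rewrite ropnormN; exact: lerD h1 (ltW h2).
Qed.

Lemma Lcvg_closed (A : set (Lss R)) u y :
  closed A -> (forall n, A (u n)) -> Lcvg u y -> A y.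
Proof.
by move=> cA Au /LcvgP uy; apply: (@closed_cvg _ _ \oo _ u A cA _ y uy); apply: nearW.
Qed.

(** The set of v with |T v|_k < e for all k <= q serves as the absolutely convex neighbourhood: the
    larger of two such norms bounds the combination. It contains a ball of s'_r by the bound at
    index max(q, r), since |.|_k <= |.|_max and |.|'_max <= |.|'_r. *)
Lemma Lss_of_bounds (T : sdual R -> sspace R) : linear T ->
  (forall q, exists2 C, 0 <= C & forall w : sdual R, wfin (- q%:Z) w ->
     rwnorm q (T w) <= C * rwnorm (- q%:Z) w) -> T \in @Lss_pred R.
Proof.
move=> lT bT; apply/asboolP; split => // w A [q [e [e0 h]]].
have T0 : T 0 = 0.
  by have := lT (-1) 0 0; rewrite scaler0 addr0 scaleN1r addNr.
have TB a b : T (a - b) = T a - T b.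
  by have := lT (-1) b a; rewrite !scaleN1r ![- _ + _]addrC.
exists [set v | forall k, (k <= q)%N -> (wnorm k (T v) < e%:E)%E].
split.
- split.
    by move=> k kq; rewrite T0 wnorm0 lte_fin.
  move=> v1 v2 a b h1 h2 ab k kq.
  have -> : T (a *: v1 + b *: v2) = a *: T v1 + b *: T v2.
    by rewrite lT; congr (_ + _); have := lT b v2 0; rewrite !addr0 T0 addr0.
  have {}h1 := h1 k kq; have {}h2 := h2 k kq.
  rewrite !rwnormE ?lte_fin in h1 h2 *; try exact: s_wfin.
  apply: le_lt_trans (s_rwnormD _ _ _) _; rewrite !s_rwnormZ.
  set w1 := rwnorm k (T v1) in h1 *; set w2 := rwnorm k (T v2) in h2 *.
  have [w12|w12] := leP w1 w2.
    apply: le_lt_trans h2; apply: (@le_trans _ _ ((normc a + normc b) * w2)).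
      by rewrite mulrDl lerD2r ler_wpM2l ?normc_ge0.
    by rewrite -[leRHS]mul1r ler_wpM2r ?rwnorm_ge0.
  apply: le_lt_trans h1; apply: (@le_trans _ _ ((normc a + normc b) * w1)).
    by rewrite mulrDl lerD2l ler_wpM2l ?normc_ge0// ltW.
  by rewrite -[leRHS]mul1r ler_wpM2r ?rwnorm_ge0.
- move=> r; have [C C0 hC] := bT (maxn q r).
  have C1 : 0 < C + 1 by rewrite ltr_wpDl.
  exists (e / (C + 1)); first exact: divr_gt0.
  move=> v hv k kq; rewrite rwnormE ?s_wfin// lte_fin.
  have fr : wfin (- r%:Z) v by apply: lt_trans hv (ltry _).
  have mr : - (maxn q r)%:Z <= - r%:Z by rewrite lerN2 lez_nat leq_maxr.
  have fm := wfin_le mr fr.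
  apply: (@le_lt_trans _ _ (C * rwnorm (- (maxn q r)%:Z) v)).
    apply: le_trans (hC v fm); apply: rwnorm_le (s_wfin _ _).
    by rewrite lez_nat (leq_trans kq)// leq_maxl.
  have {}hv : rwnorm (- (maxn q r)%:Z) v < e / (C + 1).
    apply: le_lt_trans (rwnorm_le mr fr) _; rewrite -lte_fin -rwnormE//.
  apply: (@le_lt_trans _ _ ((C + 1) * rwnorm (- (maxn q r)%:Z) v)).
    by rewrite ler_wpM2r ?rwnorm_ge0// lerDl.
  by rewrite mulrC -ltr_pdivlMr.
- move=> v hv; apply: h => k kq; have := hv k kq.
  by rewrite -TB addrC addKr.
Qed.

Lemma partial_sums_cauchy (a : nat -> R) (B e : R) : (forall n, 0 <= a n) ->
  (forall n, \sum_(i < n) a i <= B) -> 0 < e ->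
  exists N, forall n m, (N <= n)%N -> (n <= m)%N -> \sum_(n <= i < m) a i < e.
Proof.
move=> a0 aB e0; pose A := range (fun n => \sum_(i < n) a i).
have supA : has_sup A.
  by split; [exists (\sum_(i < 0) a i), 0%N|exists B => _ [n _ <-]].
have [_ [N _ <-] hN] := sup_adherent e0 supA.
exists N => n m Nn nm.
have : \sum_(i < m) a i <= sup A by apply: sup_upper_bound => //; exists m.
rewrite -!(big_mkord xpredT) (@big_cat_nat _ _ _ n)//= (@big_cat_nat _ _ _ N _ n)//=.
rewrite big_mkord; have : 0 <= \sum_(N <= i < n) a i by apply: sumr_ge0.
lra.
Qed.

(** For fixed w the coordinates of the partial sums converge absolutely. The Fatou property carries
    the norm bounds over to the limit, which makes it an operator in L(s', s); applied to the tails,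
    it gives convergence in every norm. *)
Lemma Lss_complete u (B : nat -> R) :
  (forall q n, \sum_(i < n) ropnorm q (u i) <= B q) ->
  exists y, Lcvg (fun n => \sum_(i < n) u i) y.
Proof.
move=> uB.
have B0 q : 0 <= B q by have := uB q 0%N; rewrite big_ord0.
pose S n (w : sdual R) := (\sum_(i < n) u i) w.
have SE n w j : Defs.sval (S n w) j = \sum_(i < n) Defs.sval (u i w) j.
  rewrite /S LssE_sum; elim/big_rec2 : _ => // i a b _ <-.
  by rewrite s_valD.
have Sb q n (w : sdual R) : wfin (- q%:Z) w -> rwnorm q (S n w) <= B q * rwnorm (- q%:Z) w.
  move=> fw; apply: le_trans (ropnorm_ub _ fw) _; rewrite ler_wpM2r ?rwnorm_ge0//.
  exact: le_trans (ropnorm_sum _ _ _) (uB _ _).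
pose T0 (w : sdual R) : nat -> R[i] := fun j => csum (fun i => Defs.sval (u i w) j).
have T0lim w j : climit (fun n => Defs.sval (S n w) j) (T0 w j).
  have [q /(_ q (leqnn q)) fw] := sdual_wfin w.
  have -> : (fun n => Defs.sval (S n w) j) =
    (fun n => \sum_(i < n) Defs.sval (u i w) j) by apply/funext => n; exact: SE.
  apply: csum_climit; exists (B q * rwnorm (- q%:Z) w) => n.
  apply: le_trans (_ : \sum_(i < n) ropnorm q (u i) * rwnorm (- q%:Z) w <= _).
    apply: ler_sum => i _; apply: le_trans (ropnorm_ub (u i) fw).
    by apply: le_trans (rwnorm_coord _ (s_wfin _ _)) _; exact: rwnorm_le (s_wfin _ _).
  by rewrite -mulr_suml ler_wpM2r ?rwnorm_ge0.
have T0b q (w : sdual R) : wfin (- q%:Z) w -> (wnorm q (T0 w) <= (B q * rwnorm (- q%:Z) w)%:E)%E.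
  move=> fw; apply: (@rwnorm_liminf _ _ (fun n => Defs.sval (S n w)) _ _ 0%N).
  - by rewrite mulr_ge0 ?rwnorm_ge0.
  - exact: T0lim.
  - by move=> n _; rewrite rwnormE ?s_wfin// lee_fin Sb.
have T0s w : T0 w \in @s_pred R.
  (* A given w is known to lie in s'_q for large q only, so |T0 w|_r is bounded at the index max(q,
     r). *)
  apply/asboolP => r; have [q hq] := sdual_wfin w.
  have /T0b h : wfin (- (maxn q r)%:Z) w by apply: hq; exact: leq_maxl.
  apply: (@wfin_le _ _ (maxn q r)); first by rewrite lez_nat leq_maxr.
  by apply: le_lt_trans h (ltry _).
pose T w : sspace R := SSpace (T0s w).
have TL : T \in @Lss_pred R.
  apply: Lss_of_bounds => [a v w|q].
    apply/val_inj/funext => j; apply: (climit_unique (T0lim _ j)).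
    have := climitD (climitZ a (T0lim v j)) (T0lim w j).
    congr climit; apply/funext => n; rewrite /S Lss_mapD Lss_mapZ.
    by rewrite s_valD s_valZ.
  exists (B q); first exact: B0.
  by move=> w /T0b /wnorm_fin_le[].
exists (MkLss TL) => q e e0.
have e2 : 0 < e / 2 by rewrite divr_gt0.
have [N hN] := partial_sums_cauchy (fun i => ropnorm_ge0 q (u i)) (uB q) e2.
exists N => n Nn; apply: (@le_lt_trans _ _ (e / 2)); last by lra.
rewrite ropnorm_distC; apply: ropnorm_le; first exact: ltW.
move=> w fw.
have : (wnorm q (T0 w - Defs.sval (S n w))%R <= (e / 2 * rwnorm (- q%:Z) w)%:E)%E.
  apply: (@rwnorm_liminf _ _ (fun m => Defs.sval (S m w) - Defs.sval (S n w)) _ _ n).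
  - by rewrite mulr_ge0 ?rwnorm_ge0// ltW.
  - move=> j; have := climitD (T0lim w j) _; apply => e' e'0; exists 0%N => m _.
    by rewrite subrr ComplexField.Normc.normc0.
  - move=> m nm; have -> : Defs.sval (S m w) - Defs.sval (S n w) =
        Defs.sval ((\sum_(n <= i < m) u i) w).
      have -> : S m w = S n w + (\sum_(n <= i < m) u i) w.
        rewrite /S -LssDE; congr (Lssval _ w).
        by rewrite -!(big_mkord xpredT) (@big_cat_nat _ _ _ n).
      by rewrite s_valD addrC addKr.
    rewrite rwnormE ?s_wfin// lee_fin; apply: le_trans (ropnorm_ub _ fw) _.
    rewrite ler_wpM2r ?rwnorm_ge0//; apply: le_trans (ropnorm_sum _ _ _) _.
    exact/ltW/hN.
by move=> /wnorm_fin_le[].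
Qed.

End operator_limits.

(** * Continuity and uniqueness of adjoints *)

Section adjoints.
Variable R : realType.
Implicit Types (y z : Lss R) (xi eta : l2space R).

Lemma is_adjointP y z : is_adjoint y z <-> forall xi eta,
  cinner (y (l2_to_sdual xi)) eta = cinner xi (z (l2_to_sdual eta)).
Proof. by []. Qed.

Lemma cinner_opDl y z xi eta : cinner ((y + z) (l2_to_sdual xi)) eta =
  cinner (y (l2_to_sdual xi)) eta + cinner (z (l2_to_sdual xi)) eta.
Proof.
rewrite LssDE s_valD; move: (y _) (z _) => u v.
exact: (cinnerDl (s_wfin 0 u) (s_wfin 0 v) (l2_wfin eta)).
Qed.

Lemma cinner_opZl a y xi eta : cinner ((a *: y) (l2_to_sdual xi)) eta =
  a * cinner (y (l2_to_sdual xi)) eta.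
Proof.
rewrite LssZE s_valZ; move: (y _) => u.
exact: (cinnerZl a (s_wfin 0 u) (l2_wfin eta)).
Qed.

Lemma cinner_opDr y z xi eta : cinner xi ((y + z) (l2_to_sdual eta)) =
  cinner xi (y (l2_to_sdual eta)) + cinner xi (z (l2_to_sdual eta)).
Proof.
rewrite LssDE s_valD; move: (y _) (z _) => u v.
exact: (cinnerDr (s_wfin 0 u) (s_wfin 0 v) (l2_wfin xi)).
Qed.

Lemma cinner_opZr a y xi eta : cinner xi ((a *: y) (l2_to_sdual eta)) =
  conjc a * cinner xi (y (l2_to_sdual eta)).
Proof.
rewrite LssZE s_valZ; move: (y _) => u.
exact: (cinnerZr a (s_wfin 0 u) (l2_wfin xi)).
Qed.

Lemma cinner_opBl y z xi eta : cinner ((y - z) (l2_to_sdual xi)) eta =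
  cinner (y (l2_to_sdual xi)) eta - cinner (z (l2_to_sdual xi)) eta.
Proof. by rewrite -scaleN1r cinner_opDl cinner_opZl mulN1r. Qed.

Lemma cinner_opBr y z xi eta : cinner xi ((y - z) (l2_to_sdual eta)) =
  cinner xi (y (l2_to_sdual eta)) - cinner xi (z (l2_to_sdual eta)).
Proof.
by rewrite -scaleN1r cinner_opDr cinner_opZr rmorphN rmorph1 mulN1r.
Qed.

Lemma cinner_opl_le y xi eta :
  normc (cinner (y (l2_to_sdual xi)) eta) <= ropnorm 0 y * (rwnorm 0 xi * rwnorm 0 eta).
Proof.
have := @cinner_le _ 0 _ _ (s_wfin _ (y (l2_to_sdual xi))) (l2_wfin eta).
rewrite oppr0 => /le_trans; apply; rewrite mulrA ler_wpM2r ?rwnorm_ge0//.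
exact: (ropnorm_ub_l2 0 y xi).
Qed.

Lemma cinner_opr_le y xi eta :
  normc (cinner xi (y (l2_to_sdual eta))) <= ropnorm 0 y * (rwnorm 0 xi * rwnorm 0 eta).
Proof.
have fx : wfin (- 0) xi by rewrite oppr0; exact: l2_wfin.
have := @cinner_le _ 0 _ _ fx (s_wfin _ (y (l2_to_sdual eta))).
rewrite oppr0 => /le_trans; apply; rewrite mulrCA ler_wpM2l ?rwnorm_ge0//.
exact: (ropnorm_ub_l2 0 y eta).
Qed.

Lemma adjointZ a y y' : is_adjoint y y' -> is_adjoint (a *: y) (conjc a *: y').
Proof.
move=> /is_adjointP yy'; apply/is_adjointP => xi eta.
by rewrite cinner_opZl (yy' xi eta) cinner_opZr conjcK.
Qed.

Lemma adjointD y y' z z' : is_adjoint y y' -> is_adjoint z z' ->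
  is_adjoint (y + z) (y' + z').
Proof.
move=> /is_adjointP yy' /is_adjointP zz'; apply/is_adjointP => xi eta.
by rewrite cinner_opDl (yy' xi eta) (zz' xi eta) cinner_opDr.
Qed.

Lemma adjoint0 : is_adjoint (0 : Lss R) 0.
Proof.
apply/is_adjointP => xi eta; rewrite cinner0l cinnerC ?cinner0l ?conjc0//.
  exact: wfin0.
exact: l2_wfin.
Qed.

Lemma adjoint_sum n (F G : nat -> Lss R) : (forall i, is_adjoint (F i) (G i)) ->
  is_adjoint (\sum_(i < n) F i) (\sum_(i < n) G i).
Proof.
move=> FG; elim: n => [|n IH]; first by rewrite !big_ord0; exact: adjoint0.
by rewrite !big_ord_recr/=; exact: adjointD.
Qed.

Lemma adjoint_lim (u v : nat -> Lss R) y z : Lcvg u y -> Lcvg v z ->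
  (forall n, is_adjoint (u n) (v n)) -> is_adjoint y z.
Proof.
move=> uy vz uv; apply/is_adjointP => xi eta.
(* [g] will be a constant function, so [g 0%N] is the limit of [f]. *)
have lim0 (f g : nat -> R[i]) (w : nat -> Lss R) l : Lcvg w l -> (forall n,
    normc (f n - g 0%N) <= ropnorm 0 (w n - l) * (rwnorm 0 xi * rwnorm 0 eta)) ->
    climit f (g 0%N).
  move=> wl fg e e0.
  have K1 : 0 < rwnorm 0 xi * rwnorm 0 eta + 1 by rewrite ltr_wpDl// mulr_ge0 ?rwnorm_ge0.
  have [N hN] := wl 0%N _ (divr_gt0 e0 K1).
  exists N => n /hN hn; apply: le_lt_trans (fg n) _.
  apply: (@le_lt_trans _ _ (ropnorm 0 (w n - l) * (rwnorm 0 xi * rwnorm 0 eta + 1))).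
    by rewrite ler_wpM2l ?ropnorm_ge0// lerDl.
  by rewrite -ltr_pdivlMr.
apply: (@climit_unique _ (fun n => cinner (u n (l2_to_sdual xi)) eta)).
  apply: (lim0 _ (fun=> _) u y uy) => n.
  by rewrite -cinner_opBl; exact: cinner_opl_le.
rewrite (_ : (fun n => _) = (fun n => cinner xi (v n (l2_to_sdual eta)))); last first.
  by apply/funext => n; exact: uv.
apply: (lim0 _ (fun=> _) v z vz) => n.
by rewrite -cinner_opBr; exact: cinner_opr_le.
Qed.

(** By density of l2 in s'_q, the norm ||y - z||_q is already determined on l2. *)
Lemma Lss_eq_l2 y z : (forall xi, y (l2_to_sdual xi) = z (l2_to_sdual xi)) -> y = z.
Proof.
move=> yz; apply: subr0_eq; apply: ropnorm_eq0 => q.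
apply/eqP; rewrite eq_le ropnorm_ge0 andbT; apply: ropnorm_le_l2 => // xi.
by rewrite LssDE LssNE yz subrr rwnorm0 mul0r.
Qed.

(** Pairing (z - z') eta with itself and using both adjoint identities gives |(z - z') eta|_0^2 =
    0. *)
Lemma adjoint_unique y z z' : is_adjoint y z -> is_adjoint y z' -> z = z'.
Proof.
move=> /is_adjointP yz /is_adjointP yz'; apply: subr0_eq.
apply: Lss_eq_l2 => eta; apply/val_inj.
apply: (@rwnorm_eq0 _ 0); first exact: s_wfin.
apply/eqP; rewrite -sqrf_eq0; apply/eqP/complexI.
rewrite -cinner_self; last exact: s_wfin.
have := cinner_opBr z z' (s_to_l2 ((z - z') (l2_to_sdual eta))) eta.
by rewrite -yz -yz' subrr.
Qed.

End adjoints.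

(** * Orthogonal projections and their functional calculus *)

Section projections.
Variable R : realType.
Implicit Types (P y : Lss R) (q : nat).

(** <P xi, P xi> = <xi, P P xi> = <xi, P xi>, which is estimated by the duality of |.|'_q and
    |.|_q. *)
Lemma projection_duality P q (xi : l2space R) : is_projection P ->
  rwnorm 0 (P (l2_to_sdual xi)) ^+ 2 <= rwnorm (- q%:Z) xi * rwnorm q (P (l2_to_sdual xi)).
Proof.
move=> [PP /is_adjointP Padj]; set u := P (l2_to_sdual xi).
have Pu : P (l2_to_sdual (s_to_l2 u)) = u.
  by rewrite -[LHS]/(Lmul P P (l2_to_sdual xi)) PP.
rewrite -[leLHS](ger0_norm (sqr_ge0 _)) -normc_real -cinner_self; last exact: s_wfin.
rewrite [X in cinner X _](_ : _ = Defs.sval (P (l2_to_sdual xi)))//.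
rewrite (Padj xi (s_to_l2 u)) Pu.
exact: cinner_le (l2_wfinN q xi) (s_wfin q u).
Qed.

(* With [u = P xi], three estimates are combined: [|u|_0^2 <= |xi|'_q |u|_q]
   by self-adjointness, the interpolation inequalities
   [|u|_q^2 <= |u|_0 |u|_2q] and [|u|_2q^2 <= |u|_0 |u|_4q], and
   [|a| |u|_4q = |y u|_4q <= ||y||_4q |u|_0]. *)
Lemma projection_eigenvalue_bound P y a q : is_projection P -> Lmul y P = a *: P ->
  normc a * ropnorm q P ^+ 2 <= ropnorm (4 * q) y.
Proof.
move=> projP yP.
have [->|a0] := eqVneq a 0.
  by rewrite ComplexField.Normc.normc0 mul0r ropnorm_ge0.
have al0 := normc_gt0 a0; set al := normc a in al0 *.
have Y0 := ropnorm_ge0 (4 * q) y; set Y := ropnorm _ y in Y0 *.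
have Ya0 : 0 <= Y / al by rewrite divr_ge0// ltW.
have X (xi : l2space R) : rwnorm q (P (l2_to_sdual xi)) <= Num.sqrt (Y / al) * rwnorm (- q%:Z) xi.
  set u := P (l2_to_sdual xi).
  have h0 : rwnorm 0 u ^+ 2 <= rwnorm (- q%:Z) xi * rwnorm q u by exact: projection_duality.
  have [_ h1] : wfin q u /\ rwnorm q u ^+ 2 <= rwnorm 0 u * rwnorm (2 * q)%N u.
    by apply: rwnorm_interpolation; rewrite ?PoszM ?add0r//; exact: s_wfin.
  have [_ h2] : wfin (2 * q)%N u /\ rwnorm (2 * q)%N u ^+ 2 <= rwnorm 0 u * rwnorm (4 * q)%N u.
    by apply: rwnorm_interpolation; [lia| |]; exact: s_wfin.
  have h3 : al * rwnorm (4 * q)%N u <= Y * rwnorm 0 u.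
    rewrite -s_rwnormZ.
    have -> : a *: u = y (s_to_sdual u) by rewrite -[LHS]/((a *: P) (l2_to_sdual xi)) -yP.
    apply: le_trans (ropnorm_ub_s (4 * q) y u) _; rewrite ler_wpM2l//.
    by apply: rwnorm_le (s_wfin _ _); lia.
  have n0 := rwnorm_ge0 0 u; have nq := rwnorm_ge0 q u; have n2 := rwnorm_ge0 (2 * q)%N u.
  have n4 := rwnorm_ge0 (4 * q)%N u; have nx := rwnorm_ge0 (- q%:Z) xi.
  (* A, B, C, D are the norms of u of index 0, q, 2q, 4q and E = |xi|'_q. The goal becomes al B^2 <=
     Y E^2, and after multiplication by B^2 it follows from al B^4 <= al A^2 C^2 <= al A^3 D <= Y
     A^4 <= Y E^2 B^2. *)
  move: (rwnorm 0 u) (rwnorm q u) (rwnorm (2 * q)%N u) (rwnorm (4 * q)%N u) (rwnorm (- q%:Z) xi)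
    h0 h1 h2 h3 n0 nq n2 n4 nx => {u} A B C D E h0 h1 h2 h3 A0 B0 C0 D0 E0.
  rewrite -(ler_pXn2r (n := 2))// ?nnegrE ?mulr_ge0 ?sqrtr_ge0//.
  rewrite exprMn sqr_sqrtr// mulrAC ler_pdivlMr//.
  have [->|B1] := eqVneq B 0; first by rewrite expr0n mul0r mulr_ge0 ?sqr_ge0.
  have BB : 0 < B ^+ 2 by rewrite exprn_gt0// lt_neqAle eq_sym B1.
  rewrite -(ler_pM2r BB).
  have k1 : (B ^+ 2) ^+ 2 <= A ^+ 3 * D.
    apply: (@le_trans _ _ ((A * C) ^+ 2)); first by rewrite ler_pXn2r ?nnegrE ?mulr_ge0 ?sqr_ge0.
    have -> : A ^+ 3 * D = A ^+ 2 * (A * D) by ring.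
    by rewrite exprMn ler_wpM2l ?sqr_ge0.
  have k2 : (A ^+ 2) ^+ 2 <= (E * B) ^+ 2 by rewrite ler_pXn2r ?nnegrE ?mulr_ge0 ?sqr_ge0.
  have -> : B ^+ 2 * al * B ^+ 2 = al * (B ^+ 2) ^+ 2 by ring.
  apply: (@le_trans _ _ (al * (A ^+ 3 * D))); first by rewrite ler_wpM2l// ltW.
  have -> : al * (A ^+ 3 * D) = A ^+ 3 * (al * D) by ring.
  apply: (@le_trans _ _ (A ^+ 3 * (Y * A))); first by rewrite ler_wpM2l ?exprn_ge0.
  have -> : A ^+ 3 * (Y * A) = Y * (A ^+ 2) ^+ 2 by ring.
  have -> : Y * E ^+ 2 * B ^+ 2 = Y * (E * B) ^+ 2 by ring.
  by rewrite ler_wpM2l.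
have /ropnorm_le_l2 /(_ X) h : 0 <= Num.sqrt (Y / al) by exact: sqrtr_ge0.
rewrite mulrC -ler_pdivlMr// -[leRHS]sqr_sqrtr//.
by rewrite ler_pXn2r ?nnegrE ?ropnorm_ge0 ?sqrtr_ge0.
Qed.

Lemma projection_ropnorm_sqr P q : is_projection P -> ropnorm q P ^+ 2 <= ropnorm (4 * q) P.
Proof.
move=> projP; have := @projection_eigenvalue_bound P P 1 q projP.
by rewrite ComplexField.Normc.normc1 mul1r scale1r; apply; case: projP.
Qed.

Lemma projection_ropnorm_ge1 P q : P != 0 -> is_projection P -> 1 <= ropnorm q P.
Proof.
move=> P0 [PP _]; apply: le_trans (ropnorm_mono P (leq0n q)).
by rewrite -lee_fin -ropnormE; exact: opnorm_projection.
Qed.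

Lemma projection_unit_vector P : P != 0 -> is_projection P ->
  exists w : sspace R, rwnorm 0 w = 1 /\ P (s_to_sdual w) = w.
Proof.
move=> P0 [PP _].
have [u Pu] : exists u, P u != 0.
  apply: contrapT => /forallNP h; move/eqP: P0; apply; apply: Lss_eq => u.
  by apply/eqP; have /negP := h u; rewrite negbK.
have r0 : 0 < rwnorm 0 (P u).
  rewrite lt_neqAle rwnorm_ge0 andbT eq_sym; apply: contra Pu => /eqP h.
  by apply/eqP/val_inj; exact: rwnorm_eq0 (s_wfin 0 (P u)) h.
exists ((((rwnorm 0 (P u))^-1)%:C)%C *: P u); split.
  by rewrite s_rwnormZ normc_real ger0_norm ?invr_ge0 ?rwnorm_ge0// mulVf// gt_eqF.
have -> : s_to_sdual ((((rwnorm 0 (P u))^-1)%:C)%C *: P u) =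
   (((rwnorm 0 (P u))^-1)%:C)%C *: s_to_sdual (P u) by exact: val_inj.
by rewrite Lss_mapZ -[P (s_to_sdual _)]/(Lmul P P u) PP.
Qed.

(** 1 = |w|_0^2 <= |w|_1 |w|'_1 by interpolation, and |w|_1 = |P w|_1 <= ||P||_1 |w|'_1. *)
Lemma projection_ropnorm1_ge P (w : sspace R) : rwnorm 0 w = 1 -> P (s_to_sdual w) = w ->
  1 <= ropnorm 1 P * rwnorm (- 1) w ^+ 2.
Proof.
move=> w1 Pw.
have [_ h1] : wfin 0 w /\ rwnorm 0 w ^+ 2 <= rwnorm 1 w * rwnorm (- 1) w.
  by apply: rwnorm_interpolation; [lia| |]; exact: s_wfin.
rewrite w1 expr1n in h1; apply: le_trans h1 _; rewrite expr2 mulrA.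
apply: ler_wpM2r; first exact: rwnorm_ge0.
by rewrite -{1}Pw; exact: (ropnorm_ub_s 1 P w).
Qed.

End projections.

(** * Bessel's inequality and negative norms of orthonormal sequences *)

Section bessel.
Variable R : realType.

Lemma sum_inv_sqr_le2 n : \sum_(j < n) (j.+1%:R ^+ 2)^-1 <= 2 :> R.
Proof.
case: n => [|n]; first by rewrite big_ord0.
(* The strengthened bound makes the induction telescope: 1/(k+1)^2 <= 1/k - 1/(k+1). *)
suff h : \sum_(j < n.+1) (j.+1%:R ^+ 2)^-1 <= 2 - n.+1%:R^-1 :> R.
  by apply: le_trans h _; rewrite gerBl invr_ge0.
elim: n => [|n IH]; first by rewrite big_ord_recr big_ord0/= expr1n; lra.
rewrite big_ord_recr/=; apply: le_trans (lerD IH (lexx _)) _.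
have k0 : 0 < n.+1%:R :> R by [].
rewrite -[n.+2%:R]natr1; move: (n.+1%:R : R) k0 => k k0.
have k2 : k != 0 by rewrite gt_eqF.
have k3 : k + 1 != 0 by rewrite gt_eqF// ltr_wpDl// ltW.
rewrite -subr_ge0.
have -> : 2 - (k + 1)^-1 - (2 - k^-1 + ((k + 1) ^+ 2)^-1) = (k * (k + 1) ^+ 2)^-1.
  by field; rewrite k3.
by rewrite invr_ge0 mulr_ge0 ?sqr_ge0// ltW.
Qed.

Lemma wsum_cvg k (xi : nat -> R[i]) : wfin k xi ->
  (fun n => wsum k n xi) @ \oo --> rwnorm k xi ^+ 2.
Proof.
move=> hx; apply/cvgrPdist_lt => e e0.
have [N hN] := wsum_approx hx e0.
exists N => // n /(wsum_mono k xi) Nn; have := wsum_le_rwnorm n hx.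
by move=> h; rewrite ger0_norm ?subr_ge0//; lra.
Qed.

Variable w : nat -> sspace R.
Hypothesis w_norm : forall n, rwnorm 0 (w n) = 1.
Hypothesis w_orth : forall m n, m != n -> cinner (w m) (w n) = 0.

Let sDl (u v t : sspace R) : cinner (u + v) t = cinner u t + cinner v t.
Proof. by rewrite s_valD; exact: (cinnerDl (s_wfin 0 u) (s_wfin 0 v) (s_wfin 0 t)). Qed.

Let sZl a (u t : sspace R) : cinner (a *: u) t = a * cinner u t.
Proof. by rewrite s_valZ; exact: (cinnerZl a (s_wfin 0 u) (s_wfin 0 t)). Qed.

Let sC (u t : sspace R) : cinner t u = conjc (cinner u t).
Proof. exact: (cinnerC (s_wfin 0 u) (s_wfin 0 t)). Qed.

(** This is Bessel's inequality for the j-th unit vector. Its projection [g N] onto the span of the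
    first N vectors satisfies |g|_0^2 = S and g_j = S, where S is the sum in question; hence S^2 <=
    |g|_0^2 = S. *)
Lemma bessel_coord j N : \sum_(n < N) normc (w n j) ^+ 2 <= 1.
Proof.
pose a n := conjc (w n j).
pose g N := \sum_(n < N) a n *: w n.
have gS N' : g N'.+1 = g N' + a N' *: w N' by rewrite /g big_ord_recr.
have g0 : g 0%N = 0 by rewrite /g big_ord0.
set S := \sum_(n < N) _.
have SE : S = \sum_(n < N) normc (w n j) ^+ 2 by [].
have gw N' m : (N' <= m)%N -> cinner (g N') (w m) = 0.
  elim: N' => [|N' IH] Nm; first by rewrite g0 cinner0l.
  by rewrite gS sDl sZl (IH (ltnW Nm)) w_orth ?mulr0 ?addr0// neq_ltn Nm.
have gg : cinner (g N) (g N) = (S%:C)%C.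
  rewrite SE; elim: (N) => [|N' IH]; first by rewrite g0 cinner0l big_ord0.
  have ww : cinner (w N') (w N') = 1.
    by rewrite (cinner_self (s_wfin 0 (w N'))) w_norm expr1n.
  have wg : cinner (w N') (g N') = 0 by rewrite sC gw// conjc0.
  have e1 : cinner (g N') (g N' + a N' *: w N') =
      ((\sum_(n < N') normc (w n j) ^+ 2)%:C)%C.
    by rewrite (sC (g N' + _)) sDl sZl IH wg mulr0 addr0 /= oppr0.
  have e2 : cinner (w N') (g N' + a N' *: w N') = w N' j.
    by rewrite (sC (g N' + _)) sDl sZl gw// ww mulr1 add0r conjcK.
  by rewrite gS sDl sZl e1 e2 big_ord_recr/= rmorphD/= mulrC mul_conjc.
have gj : g N j = (S%:C)%C.
  rewrite SE; elim: (N) => [|N' IH]; first by rewrite g0 big_ord0.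
  rewrite gS s_valD s_valZ -[LHS]/(g N' j + a N' * w N' j) IH.
  by rewrite big_ord_recr/= rmorphD/= mulrC mul_conjc.
have S0 : 0 <= S by apply: sumr_ge0 => n _; exact: sqr_ge0.
have nS : rwnorm 0 (g N) ^+ 2 = S.
  by apply: complexI; rewrite -(cinner_self (s_wfin 0 (g N))).
have := rwnorm_coord j (s_wfin 0 (g N)); rewrite gj normc_real ger0_norm// => h.
rewrite leNgt; apply/negP => S1.
have : S ^+ 2 <= S by rewrite -[leRHS]nS ler_pXn2r ?nnegrE ?rwnorm_ge0.
by rewrite leNgt expr2 ltr_pMr ?S1//; apply: lt_trans S1.
Qed.

(** Exchanging the sums over n and j, the sum over n is at most 1 for each coordinate j, and the
    weights j^(-2) remain. The exchange is made for partial sums in j, before passing to the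
    limit. *)
Lemma sum_rwnormN1_le2 N : \sum_(n < N) rwnorm (- 1) (w n) ^+ 2 <= 2.
Proof.
have cv : (fun p => \sum_(n < N) wsum (- 1) p (w n)) @ \oo -->
    \sum_(n < N) rwnorm (- 1) (w n) ^+ 2.
  apply: cvg_big => [|j _]; first exact: add_continuous.
  exact: wsum_cvg (s_wfin (-1) (w j)).
rewrite -(cvg_lim _ cv)//; apply: limr_le; first by apply/cvg_ex; eexists; exact: cv.
apply: nearW => p; rewrite /wsum exchange_big/=.
apply: le_trans (sum_inv_sqr_le2 p); apply: ler_sum => j _.
rewrite -mulr_suml -[leRHS]mul1r.
have -> : j.+1%:R ^ (2 * -1) = (j.+1%:R ^+ 2)^-1 :> R by [].
by rewrite ler_wpM2r ?bessel_coord// invr_ge0 sqr_ge0.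
Qed.

End bessel.

(** * Series of multiples of orthogonal projections *)

Section orthogonal_projections.
Variables (R : realType) (P : nat -> Lss R).
Hypothesis P_neq0 : forall n, P n != 0.
Hypothesis P_proj : forall n, is_projection (P n).
Hypothesis P_orth : forall m n, m != n -> Lmul (P m) (P n) = 0.
Implicit Types (a b : nat -> R[i]) (y z : Lss R) (q : nat).

Lemma sum_inv_ropnorm1_le2 N : \sum_(n < N) (ropnorm 1 (P n))^-1 <= 2.
Proof.
have /choice[w wP] : forall n, exists w : sspace R,
    rwnorm 0 w = 1 /\ P n (s_to_sdual w) = w.
  by move=> n; exact: projection_unit_vector.
have w_orth m n : m != n -> cinner (w m) (w n) = 0.
  move=> mn; have [_ wm] := wP m; have [_ wn'] := wP n.
  have [_ /is_adjointP Padj] := P_proj m.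
  (* <w_m, w_n> = <P_m w_m, w_n> = <w_m, P_m w_n>, and P_m w_n = P_m P_n w_n = 0. *)
  have := Padj (s_to_l2 (w m)) (s_to_l2 (w n)).
  rewrite -[P m (l2_to_sdual (s_to_l2 (w m)))]/(P m (s_to_sdual (w m))) wm.
  have -> : P m (l2_to_sdual (s_to_l2 (w n))) = 0.
    rewrite -[LHS]/(P m (s_to_sdual (w n))) -wn'.
    by rewrite -[LHS]/(Lmul (P m) (P n) (s_to_sdual (w n))) P_orth.
  move=> h; apply: (etrans h).
  have := cinnerC (@wfin0 R 0) (s_wfin 0 (w m)).
  by rewrite cinner0l conjc0.
apply: le_trans (sum_rwnormN1_le2 (fun n => (wP n).1) w_orth N).
apply: ler_sum => n _; have [w1 Pw] := wP n.
have p1 : 0 < ropnorm 1 (P n) := lt_le_trans ltr01 (projection_ropnorm_ge1 1 (P_neq0 n) (P_proj n)).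
rewrite -[leLHS]mul1r ler_pdivrMr// mulrC; exact: projection_ropnorm1_ge.
Qed.

(** A relation, since the series converges only for suitable coefficients. By [calc_ex] the next
    condition, that of C_s for a_n = f(lambda_n), is sufficient. *)
Definition is_calc a y := Lcvg (fun N => \sum_(n < N) a n *: P n) y.

Definition coeff_bounded a := forall q, exists C, forall n, normc (a n) * ropnorm q (P n) <= C.

(** ||P||_q ||P||_1 <= ||P||_(q+1)^2 <= ||P||_(4(q+1)), so that ||a_n P_n||_q <= C / ||P_n||_1. *)
Lemma sum_ropnorm_le a q (C : R) N : (forall n, normc (a n) * ropnorm (4 * q.+1) (P n) <= C) ->
  \sum_(n < N) ropnorm q (a n *: P n) <= 2 * C.
Proof.
move=> aC.
have C0 : 0 <= C by apply: le_trans (aC 0%N); rewrite mulr_ge0 ?normc_ge0 ?ropnorm_ge0.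
apply: (@le_trans _ _ (\sum_(n < N) (ropnorm 1 (P n))^-1 * C)); last first.
  by rewrite -mulr_suml ler_wpM2r// sum_inv_ropnorm1_le2.
apply: ler_sum => n _; rewrite ropnormZ.
have p1 : 0 < ropnorm 1 (P n) := lt_le_trans ltr01 (projection_ropnorm_ge1 1 (P_neq0 n) (P_proj n)).
rewrite ler_pdivlMl//.
apply: le_trans (aC n); rewrite mulrCA ler_wpM2l ?normc_ge0//.
apply: le_trans (projection_ropnorm_sqr q.+1 (P_proj n)).
by rewrite expr2 ler_pM ?ropnorm_ge0 ?ropnorm_mono.
Qed.

Lemma calc_ex a : coeff_bounded a -> exists y, is_calc a y.
Proof.
move=> ab; have /choice[C aC] q : exists C, forall n,
    normc (a n) * ropnorm (4 * q.+1) (P n) <= C by exact: ab.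
by apply: (@Lss_complete R (fun n => a n *: P n) (fun q => 2 * C q)) => q n; exact: sum_ropnorm_le.
Qed.

Lemma calc_ropnorm_le a y q (C : R) : is_calc a y ->
  (forall n, normc (a n) * ropnorm (4 * q.+1) (P n) <= C) -> ropnorm q y <= 2 * C.
Proof.
move=> ay aC; apply: (@Lcvg_ropnorm_le _ q _ y _ 0%N _ ay) => n _.
by apply: le_trans (ropnorm_sum _ _ _) _; exact: sum_ropnorm_le.
Qed.

Lemma sum_mulP a n N : (n < N)%N ->
  Lmul (\sum_(i < N) a i *: P i) (P n) = a n *: P n.
Proof.
move=> nN; rewrite Lmul_suml (bigD1 (Ordinal nN))//= big1 ?addr0.
  by rewrite LmulZl; case: (P_proj n) => ->.
by move=> i iN; rewrite LmulZl P_orth ?scaler0.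
Qed.

Lemma Lcvg_cst y : Lcvg (fun=> y) y.
Proof. by move=> q e e0; exists 0%N => n _; rewrite subrr ropnorm0. Qed.

Lemma Lcvg_eventually (u v : nat -> Lss R) y N : (forall n, (N <= n)%N -> u n = v n) ->
  Lcvg v y -> Lcvg u y.
Proof.
move=> uv vy q e /(vy q)[M hM]; exists (maxn N M) => n.
by rewrite geq_max => /andP[/uv -> /hM].
Qed.

Lemma calc_mulP a y n : is_calc a y -> Lmul y (P n) = a n *: P n.
Proof.
move=> /(Lcvg_Lmulr (P n)) h; apply: Lcvg_unique h _.
by apply: (@Lcvg_eventually _ (fun=> a n *: P n) _ n.+1) => [m|];
  [exact: sum_mulP|exact: Lcvg_cst].
Qed.

Lemma is_calc_ext a b y : (forall n, a n = b n) -> is_calc a y -> is_calc b y.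
Proof. by move=> /funext ->. Qed.

(** Only [z] is expanded: y P_n = a_n P_n turns its partial sums into those of the product series,
    so no double series arises. *)
Lemma calc_mul a b y z : is_calc a y -> is_calc b z ->
  is_calc (fun n => a n * b n) (Lmul y z).
Proof.
move=> ay bz; apply: (Lcvg_eventually (N := 0%N) _ (Lcvg_Lmull y bz)) => N _.
rewrite Lmul_sumr; apply: eq_bigr => n _.
by rewrite LmulZr (calc_mulP n ay) scalerA mulrC.
Qed.

Lemma calcD a b y z : is_calc a y -> is_calc b z ->
  is_calc (fun n => a n + b n) (y + z).
Proof.
move=> ay bz; apply: (Lcvg_eventually (N := 0%N) _ (LcvgD ay bz)) => N _.
by rewrite -big_split; apply: eq_bigr => n _ /=; rewrite scalerDl.
Qed.

Lemma calcZ c a y : is_calc a y -> is_calc (fun n => c * a n) (c *: y).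
Proof.
move=> ay; apply: (Lcvg_eventually (N := 0%N) _ (LcvgZ c ay)) => N _.
by rewrite scaler_sumr; apply: eq_bigr => n _ /=; rewrite scalerA.
Qed.

Lemma calcB a b y z : is_calc a y -> is_calc b z ->
  is_calc (fun n => a n - b n) (y - z).
Proof.
move=> ay /(calcZ (-1)) bz; rewrite -scaleN1r.
by apply: is_calc_ext (calcD ay bz) => n; rewrite mulN1r.
Qed.

Lemma calc0 : is_calc (fun=> 0) 0.
Proof.
apply: (@Lcvg_eventually _ (fun=> 0) _ 0%N) => [n _|]; last exact: Lcvg_cst.
by rewrite big1// => i _; rewrite scale0r.
Qed.

Lemma calc_P n : is_calc (fun m => (m == n)%:R) (P n).
Proof.
apply: (@Lcvg_eventually _ (fun=> P n) _ n.+1) => [m nm|]; last exact: Lcvg_cst.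
rewrite (bigD1 (Ordinal nm))//= big1 ?addr0 ?eqxx ?scale1r// => i iN.
rewrite (_ : (i == n :> nat) = false) ?scale0r//; apply: contraNF iN => /eqP iE.
exact/eqP/val_inj.
Qed.

Lemma calc_unique a y z : is_calc a y -> is_calc a z -> y = z.
Proof. exact: Lcvg_unique. Qed.

Lemma eigen_coeff_le y c n q : Lmul y (P n) = c *: P n ->
  normc c * ropnorm q (P n) <= ropnorm (4 * q) y.
Proof.
move=> h; apply: le_trans (projection_eigenvalue_bound q (P_proj n) h).
rewrite ler_wpM2l ?normc_ge0// expr2 ler_peMl ?ropnorm_ge0//.
exact: projection_ropnorm_ge1.
Qed.

Lemma calc_coeff_le a y n q : is_calc a y -> normc (a n) * ropnorm q (P n) <= ropnorm (4 * q) y.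
Proof. by move=> /(calc_mulP n); exact: eigen_coeff_le. Qed.

Lemma calc_inj a b y : is_calc a y -> is_calc b y -> a = b.
Proof.
move=> ay yb; apply/funext => n; apply/subr0_eq/eqP; rewrite -normc_eq0 eq_le normc_ge0 andbT.
have := calc_coeff_le n 0 (calcB ay yb); rewrite subrr ropnorm0; apply: le_trans.
by rewrite ler_peMr ?normc_ge0// projection_ropnorm_ge1.
Qed.

Lemma calc_adjoint a y z : is_calc a y -> is_calc (fun n => conjc (a n)) z ->
  is_adjoint y z.
Proof.
move=> ay az; apply: (adjoint_lim ay az) => N.
apply: (@adjoint_sum _ _ (fun n => a n *: P n) (fun n => conjc (a n) *: P n)) => n.
by apply: adjointZ; case: (P_proj n).
Qed.

End orthogonal_projections.

(** * The range of the calculus as a closed star subalgebra *)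

Section calculus_range.
Variables (R : realType) (P : nat -> Lss R).
Hypothesis P_neq0 : forall n, P n != 0.
Hypothesis P_proj : forall n, is_projection (P n).
Hypothesis P_orth : forall m n, m != n -> Lmul (P m) (P n) = 0.
Implicit Types (a b : nat -> R[i]) (y z : Lss R) (q : nat).

Lemma calc_coeff_bounded a y : is_calc P a y -> coeff_bounded P a.
Proof.
move=> ay q; exists (ropnorm (4 * q) y) => n.
exact: (calc_coeff_le P_neq0 P_proj P_orth n q ay).
Qed.

Definition calc_range : set (Lss R) := [set y | exists a, is_calc P a y].

(** The eigenvalue is c = <y w, w> for a unit vector w in the range of P_n. If z = sum_m b_m P_m is
    close to y, then b_n = <z w, w> is close to c and z P_n = b_n P_n is close to y P_n. The error
    is at most 2 ||P_n||_q ||z - y||_q. *)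
Lemma calc_limit_eigen y n :
  (forall q (e : R), 0 < e -> exists2 z, calc_range z & ropnorm q (z - y) < e) ->
  exists c, Lmul y (P n) = c *: P n.
Proof.
move=> yA; have [w [w1 Pw]] := projection_unit_vector (P_neq0 n) (P_proj n).
pose wl := s_to_l2 w.
pose c := cinner (y (l2_to_sdual wl)) wl; exists c.
apply: subr0_eq; apply: ropnorm_eq0 => q.
apply/eqP; rewrite eq_le ropnorm_ge0 andbT; apply/ler_addgt0Pr => e e0; rewrite add0r.
have K0 : 0 < ropnorm q (P n) + ropnorm q (P n) + 1 by rewrite ltr_wpDl ?addr_ge0 ?ropnorm_ge0.
have [z [b bz] zy] := yA q _ (divr_gt0 e0 K0).
have zw : z (l2_to_sdual wl) = b n *: w.
  rewrite -[LHS]/(z (s_to_sdual w)) -[in LHS]Pw.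
  rewrite -[LHS]/(Lmul z (P n) (s_to_sdual w)) (calc_mulP P_proj P_orth n bz).
  by rewrite LssZE Pw.
have bE : b n = cinner (z (l2_to_sdual wl)) wl.
  rewrite zw s_valZ (cinnerZl (b n) (s_wfin 0 w) (s_wfin 0 w)).
  by rewrite (cinner_self (s_wfin 0 w)) w1 expr1n mulr1.
have bc : normc (b n - c) <= ropnorm q (z - y).
  rewrite bE /c -cinner_opBl; apply: le_trans (cinner_opl_le _ _ _) _.
  have -> : rwnorm 0 wl = 1 by [].
  rewrite !mulr1.
  exact: ropnorm_mono.
have -> : Lmul y (P n) - c *: P n = (b n - c) *: P n - Lmul (z - y) (P n).
  rewrite LmulBl (calc_mulP P_proj P_orth n bz) scalerBl opprB.
  by rewrite [RHS]addrC addrA subrK.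
apply: le_trans (ropnormD _ _ _) _; rewrite ropnormN ropnormZ.
apply: (@le_trans _ _ (ropnorm q (z - y) * (ropnorm q (P n) + ropnorm q (P n)))).
  by rewrite mulrDr lerD ?ropnormM// ler_wpM2r ?ropnorm_ge0.
apply: (@le_trans _ _ (ropnorm q (z - y) * (ropnorm q (P n) + ropnorm q (P n) + 1))).
  by rewrite ler_wpM2l ?ropnorm_ge0// lerDl.
by rewrite -ler_pdivlMr// ltW.
Qed.

(** The eigenvalues a_n of y on the ranges of the P_n define y' = sum_n a_n P_n. The coefficients
    b_n - a_n of z - y' are also the eigenvalues of z - y, hence are controlled by z - y, and z is
    close to y' as well as to y. The index is multiplied by 4 twice: for passing from eigenvalues to
    the norm of z - y', and for bounding eigenvalues by z - y. *)
Lemma calc_limit y :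
  (forall q (e : R), 0 < e -> exists2 z, calc_range z & ropnorm q (z - y) < e) ->
  calc_range y.
Proof.
move=> yA; have /choice[a aP] n := calc_limit_eigen n yA.
have ab : coeff_bounded P a.
  by move=> q; exists (ropnorm (4 * q) y) => n; exact: eigen_coeff_le.
have [y' ay'] := calc_ex P_neq0 P_proj P_orth ab.
exists a; suff -> : y = y' by [].
apply: subr0_eq; apply: ropnorm_eq0 => q.
apply/eqP; rewrite eq_le ropnorm_ge0 andbT; apply/ler_addgt0Pr => e e0; rewrite add0r.
have e3 : 0 < e / 3 by rewrite divr_gt0.
have [z [b bz] zy] := yA (4 * (4 * q.+1))%N _ e3.
have h1 : ropnorm q (z - y) <= ropnorm (4 * (4 * q.+1)) (z - y) by apply: ropnorm_mono; lia.
have h2 : ropnorm q (z - y') <= 2 * ropnorm (4 * (4 * q.+1)) (z - y).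
  apply: (calc_ropnorm_le P_neq0 P_proj P_orth (calcB bz ay')) => n.
  apply: (eigen_coeff_le P_neq0 P_proj).
  by rewrite LmulBl (calc_mulP P_proj P_orth n bz) aP scalerBl.
have := ropnormB_add q y y' z; rewrite (ropnorm_distC q y z).
move: (ropnorm q (y - y')) (ropnorm q (z - y)) (ropnorm q (z - y')) (ropnorm _ (z - y)) zy h1 h2.
by move=> A B C D; lra.
Qed.

Lemma calc_range_star : closed_star_subalgebra calc_range.
Proof.
split.
- by exists (fun=> 0); exact: calc0.
- move=> c y z [a ay] [b bz]; exists (fun n => c * a n + b n).
  exact: calcD (calcZ c ay) bz.
- by move=> y z [a ay] [b bz]; exists (fun n => a n * b n); exact: calc_mul.
(* The operator with the conjugate coefficients is an adjoint of [y], so uniqueness identifies it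
   with [z]. *)
- move=> y z [a ay] yz; pose a' n := conjc (a n).
  have ab : coeff_bounded P a'.
    move=> q; have [C aC] := calc_coeff_bounded ay q.
    by exists C => n; rewrite normc_conj.
  have [z' az'] := calc_ex P_neq0 P_proj P_orth ab.
  by exists a'; rewrite (adjoint_unique yz (calc_adjoint P_proj ay az')).
- move=> y yA; apply: calc_limit => q e e0.
  have /yA[z [zA zy]] : nbhs y [set z | forall k, (k <= q)%N -> (opnorm k (z - y)%R < e%:E)%E].
    by exists q, e; split.
  by exists z => //; have := zy q (leqnn q); rewrite ropnormE lte_fin.
Qed.

Lemma calc_subalg (A : set (Lss R)) a y : closed_star_subalgebra A ->
  (forall n, A (P n)) -> is_calc P a y -> A y.
Proof.
move=> [A0 AL _ _ cA] AP ay; apply: (Lcvg_closed cA _ ay) => N.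
elim: N => [|N IH]; first by rewrite big_ord0.
by rewrite big_ord_recr/= addrC; exact: AL.
Qed.

End calculus_range.

(** * The algebra and the spectrum of a normal operator *)

Section spectral_projections.
Variable R : realType.

(** |(z + z^2)/2| = |z| |1 + z|/2, and |1 + z| = 2 in the closed unit disc only at z = 1. Passing
    from z to (z + z^2)/2 fixes 1 and moves every other number of modulus 1 into the open disc; this
    separates an eigenvalue from others of the same modulus. *)
Lemma half_sqr_contraction (z : R[i]) : normc z <= 1 ->
  normc ((z + z ^+ 2) / 2) <= normc z /\ (z != 1 -> normc ((z + z ^+ 2) / 2) < 1).
Proof.
move=> z1; have n2 : normc (2 : R[i]) = 2.
  by rewrite -(rmorph_nat (real_complex R) 2) normc_real normr_nat.
have E : normc ((z + z ^+ 2) / 2) = normc z * (normc (1 + z) / 2).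
  by rewrite normcM normcV n2 expr2 -{1}[z]mulr1 -mulrDr normcM mulrA.
have h : normc (1 + z) <= 2.
  apply: le_trans (ler_normcD _ _) _; rewrite ComplexField.Normc.normc1; lra.
rewrite E; split.
  by rewrite -[leRHS]mulr1 ler_wpM2l ?normc_ge0// ler_pdivrMr// mul1r.
move=> zn1; apply: (@le_lt_trans _ _ (1 * (normc (1 + z) / 2))).
  by rewrite ler_wpM2r// divr_ge0 ?normc_ge0.
rewrite mul1r ltr_pdivrMr// mul1r lt_neqAle h andbT; apply: contra zn1.
move: z1 {E h}; case: z => a b /= z1 /eqP h.
have ab1 : a ^+ 2 + b ^+ 2 <= 1.
  by rewrite -[leLHS]sqr_sqrtr ?addr_ge0 ?sqr_ge0// expr_le1// sqrtr_ge0.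
have h4 : (1 + a) ^+ 2 + b ^+ 2 = 4.
  have := congr1 (fun t => t ^+ 2) h; rewrite sqr_sqrtr ?addr_ge0 ?sqr_ge0//.
  by rewrite add0r => ->; ring.
have a1 : a = 1 by nra.
have b0 : b ^+ 2 = 0 by move: h4 ab1; rewrite a1; lra.
by rewrite eq_complex/= a1 eqxx/= -sqrf_eq0 b0.
Qed.

Lemma uniform_contraction (h : nat -> R) n M : (forall m, m != n -> h m < 1) ->
  (forall m, (M <= m)%N -> h m <= 2^-1) ->
  exists th, [/\ 0 <= th, th < 1 & forall m, m != n -> h m <= th].
Proof.
move=> h1 hM; pose th := \big[Num.max/2^-1]_(m < M | val m != n) h m.
have th2 : 2^-1 <= th.
  by rewrite /th; elim/big_rec : _ => // i t _ it; rewrite le_max it orbT.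
exists th; split.
- by apply: le_trans th2; rewrite invr_ge0.
- rewrite /th; elim/big_rec : _ => [|i t hi it]; first by lra.
  by rewrite gt_max it h1.
- move=> m mn; have [mM|mM] := ltnP m M; last exact: le_trans (hM _ mM) th2.
  by rewrite /th (bigD1 (Ordinal mM))//= le_max lexx.
Qed.

Variables (P : nat -> Lss R) (lam : nat -> R[i]) (x : Lss R).
Hypothesis P_neq0 : forall n, P n != 0.
Hypothesis P_proj : forall n, is_projection (P n).
Hypothesis P_orth : forall m n, m != n -> Lmul (P m) (P n) = 0.
Hypothesis lam_neq0 : forall n, lam n != 0.
Hypothesis lam_inj : injective lam.
Hypothesis lam_noninc : forall n, normc (lam n.+1) <= normc (lam n).
Hypothesis lam_s : lam \in @s_pred R.
Hypothesis lam_x : is_calc P lam x.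

(** Since the sequence is in s, |lambda_m| (m+1) is bounded by its norm of index 1. *)
Lemma eigenvalue_decay (e : R) : 0 < e -> exists M, forall m, (M <= m)%N -> normc (lam m) <= e.
Proof.
have /asboolP /(_ 1%N) f := lam_s; move=> e0.
have C0 := rwnorm_ge0 1 lam; set C := rwnorm 1 lam in C0.
have [M hM] : exists M : nat, C / e <= M.+1%:R.
  exists (Num.truncn (C / e)); exact/ltW/truncnS_gt.
exists M => m Mm.
have m0 : 0 < m.+1%:R :> R by [].
have : (normc (lam m) * m.+1%:R) ^+ 2 <= C ^+ 2.
  apply: le_trans (wsum_le_rwnorm m.+1 f); rewrite wsumE big_ord_recr/= lerDr.
  by apply: sumr_ge0 => i _; exact: sqr_ge0.
rewrite ler_pXn2r ?nnegrE ?mulr_ge0 ?normc_ge0// -ler_pdivlMr// => /le_trans; apply.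
rewrite ler_pdivrMr// mulrC -ler_pdivrMr//; apply: le_trans hM _.
by rewrite ler_nat ltnS.
Qed.

Lemma eigenvalue_noninc m n : (n <= m)%N -> normc (lam m) <= normc (lam n).
Proof.
elim: m => [|m IH]; first by rewrite leqn0 => /eqP ->.
by rewrite leq_eqVlt => /orP[/eqP->//|/IH]; exact: le_trans (lam_noninc m).
Qed.

(** The iterate is the power v^(k+1). The coefficients of v^(k+1) - P_n vanish at n and elsewhere
    are at most th^k |h_m|. Keeping one factor h_m preserves the bound C on |h_m| ||P_m||, so the
    norm of the difference is at most 2 th^k C. *)
Lemma Lcvg_powers_projection h v n : is_calc P h v -> h n = 1 ->
  (exists th, [/\ 0 <= th, th < 1 & forall m, m != n -> normc (h m) <= th]) ->
  Lcvg (fun k => iter k (Lmul v) v) (P n).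
Proof.
move=> hv hn [th [th0 th1 hth]].
have pw k : is_calc P (fun m => h m ^+ k.+1) (iter k (Lmul v) v).
  elim: k => [|k IH]; first exact: is_calc_ext hv.
  apply: is_calc_ext (calc_mul P_proj P_orth hv IH) => m; by rewrite -exprS.
move=> q e e0; have [C hC] := calc_coeff_bounded P_neq0 P_proj P_orth hv (4 * q.+1)%N.
have C0 : 0 <= C by apply: le_trans (hC 0%N); rewrite mulr_ge0 ?normc_ge0 ?ropnorm_ge0.
have K0 : 0 < 2 * C + 1 by rewrite ltr_wpDl// mulr_ge0.
have : (fun k => th ^+ k) @ \oo --> 0 by apply: cvg_expr; rewrite ger0_norm.
move=> /cvgrPdist_lt /(_ _ (divr_gt0 e0 K0)) [N _ hN].
exists N => k /hN; rewrite sub0r normrN ger0_norm ?exprn_ge0// => thk.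
have thk0 : 0 <= th ^+ k by rewrite exprn_ge0.
apply: (@le_lt_trans _ _ (2 * (th ^+ k * C))).
  apply: (calc_ropnorm_le P_neq0 P_proj P_orth (calcB (pw k) (calc_P P n))) => m.
  have [->|mn] := eqVneq m n.
    rewrite hn expr1n subrr ComplexField.Normc.normc0 mul0r.
    by rewrite mulr_ge0.
  rewrite subr0 exprSr normcM -mulrA; apply: ler_pM; rewrite ?normc_ge0//.
    by rewrite mulr_ge0 ?normc_ge0 ?ropnorm_ge0.
  have -> : normc (h m ^+ k) = normc (h m) ^+ k.
    by elim: k {thk thk0} => [|k IH]; [exact: ComplexField.Normc.normc1|rewrite !exprS normcM IH].
  by rewrite lerXn2r ?nnegrE ?normc_ge0 ?hth.
rewrite mulrCA; apply: (@le_lt_trans _ _ (th ^+ k * (2 * C + 1))).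
  by rewrite ler_wpM2l// lerDl.
by rewrite -ltr_pdivlMr.
Qed.

(* Once [P m] is in [A] for [m < n], so is [u = sum_(m >= n) (lam m / lam n) P m].
   The coefficients [z] of [(u + u^2) / 2] satisfy [|z| < 1] uniformly, except for
   that of [P n] which is 1, hence the powers of [(u + u^2) / 2] tend to [P n]. *)
Lemma projection_in_subalg (A : set (Lss R)) n : closed_star_subalgebra A -> A x -> A (P n).
Proof.
move=> [A0 AL AM _ cA] Ax; elim/ltn_ind: n => n IH.
pose u := (lam n)^-1 *: (x - \sum_(m < n) lam m *: P m).
pose mu m := if (m < n)%N then 0 else lam m / lam n.
have sumP k : is_calc P (fun m => if (m < k)%N then lam m else 0) (\sum_(m < k) lam m *: P m).
  elim: k => [|k IHk]; first by rewrite big_ord0; exact: calc0.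
  rewrite big_ord_recr/=; apply: is_calc_ext (calcD IHk (calcZ (lam k) (calc_P P k))) => m.
  rewrite ltnS (leq_eqVlt m k); have [->|mk] := eqVneq m k; first by rewrite ltnn mulr1 add0r.
  by rewrite mulr0 addr0.
have mu_u : is_calc P mu u.
  apply: is_calc_ext (calcZ (lam n)^-1 (calcB lam_x (sumP n))) => m.
  by rewrite /mu; case: ifP; rewrite ?subrr ?mulr0 ?subr0 1?mulrC.
have Au : A u.
  rewrite /u -[X in A X]addr0; apply: (AL) => //.
  have As : A (\sum_(m < n) lam m *: P m).
    have : forall k, (k <= n)%N -> A (\sum_(m < k) lam m *: P m).
      elim=> [|k IHk] kn; first by rewrite big_ord0.
      by rewrite big_ord_recr/= addrC; apply: (AL); [exact: IH|exact/IHk/ltnW].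
    exact.
  by rewrite addrC -scaleN1r; apply: (AL).
pose v := 2^-1 *: (u + Lmul u u); pose h m := (mu m + mu m ^+ 2) / 2.
have hv : is_calc P h v.
  apply: is_calc_ext (calcZ 2^-1 (calcD mu_u (calc_mul P_proj P_orth mu_u mu_u))) => m.
  by rewrite /h expr2 mulrC.
have Av : A v.
  rewrite /v -[X in A X]addr0; apply: (AL) => //.
  by rewrite -[X in A (X + _)]scale1r; apply: (AL) => //; exact: (AM).
have mu1 m : normc (mu m) <= 1.
  rewrite /mu; case: ifPn => [_|]; first by rewrite ComplexField.Normc.normc0.
  rewrite -leqNgt => nm; rewrite normcM normcV ler_pdivrMr ?normc_gt0// mul1r.
  exact: eigenvalue_noninc.
apply: (Lcvg_closed cA (u := fun k => iter k (Lmul v) v)).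
  by elim=> // k Ak; exact: (AM).
apply: (Lcvg_powers_projection hv).
  by rewrite /h /mu ltnn divff// expr1n divff// pnatr_eq0.
(* From M on, |lambda_m| <= |lambda_n|/2, hence |mu_m| <= 1/2; finitely many indices remain. *)
have [M hM] := eigenvalue_decay (divr_gt0 (normc_gt0 (lam_neq0 n)) (ltr0n R 2)).
apply: (@uniform_contraction _ n M) => m.
  move=> mn; apply: (half_sqr_contraction (mu1 m)).2.
  rewrite /mu; case: ifPn => [_|_]; first by rewrite eq_sym oner_eq0.
  apply: contra mn => /eqP h1; apply/eqP/lam_inj.
  by rewrite -[LHS](divfK (lam_neq0 n)) h1 mul1r.
move=> Mm; apply: le_trans (half_sqr_contraction (mu1 m)).1 _.
rewrite /mu; case: ifPn => [_|_]; first by rewrite ComplexField.Normc.normc0 invr_ge0.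
rewrite normcM normcV ler_pdivrMr ?normc_gt0// mulrC; exact: hM.
Qed.

Lemma alg_calc_range : alg x = calc_range P.
Proof.
apply/seteqP; split=> [y|y [a ay] A [cA Ax]].
  apply; split; first exact: calc_range_star.
  by exists lam.
by apply: (calc_subalg cA _ ay) => n; exact: projection_in_subalg.
Qed.

End spectral_projections.

(** * The spectrum and the calculus for functions on it *)

Section spectrum_and_calculus.
Variables (R : realType) (x : Lss R) (rho : spectral_repr x).

Let P := evproj rho.
Let lam := ev rho.
Let P_neq0 : forall n, P n != 0 := evproj_neq0 rho.
Let P_proj : forall n, is_projection (P n) := evproj_projection rho.
Let P_orth : forall m n, m != n -> Lmul (P m) (P n) = 0 := @evproj_orthogonal R x rho.

Lemma is_calcP a y : is_calc P a y <-> series (fun n => a n *: P n) @ \oo --> y.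
Proof. by rewrite LcvgP seriesEord. Qed.

Lemma calc_ev : is_calc P lam x.
Proof. by apply/is_calcP; exact: spectral_cvg. Qed.

Lemma l2op_lin y a (u v : l2space R) : l2op y (a *: u + v) = a *: l2op y u + l2op y v.
Proof.
apply/val_inj; rewrite -[LHS]/(Defs.sval (y (l2_to_sdual (a *: u + v)))).
have -> : l2_to_sdual (a *: u + v) = a *: l2_to_sdual u + l2_to_sdual v by exact: val_inj.
by rewrite Lss_mapD Lss_mapZ.
Qed.

Lemma ev_in_spectrum n : spectrum x (lam n).
Proof.
move=> [T [lT _ Tl _]]; have [w [w1 Pw]] := projection_unit_vector (P_neq0 n) (P_proj n).
have xw : l2op x (s_to_l2 w) = lam n *: s_to_l2 w.
  apply/val_inj; rewrite -[LHS]/(Defs.sval (x (s_to_sdual w))) -[in LHS]Pw.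
  rewrite -[x _]/(Lmul x (P n) (s_to_sdual w)) (calc_mulP P_proj P_orth n calc_ev).
  by rewrite LssZE Pw.
have := Tl (s_to_l2 w); rewrite xw subrr.
have -> : T 0 = 0 by have := lT (-1) 0 0; rewrite scaler0 addr0 scaleN1r addNr.
move=> w0; have /eqP : rwnorm 0 w = 0 by rewrite -[Defs.sval w]/(l2val (s_to_l2 w)) -w0 rwnorm0.
by rewrite w1 oner_eq0.
Qed.

(** The eigenvalues tend to 0: all but finitely many have modulus at most |mu|/2 and thus distance
    at least |mu|/2 from mu. *)
Lemma ev_separated (mu : R[i]) : mu != 0 -> (forall n, mu != lam n) ->
  exists2 d : R, 0 < d & forall n, d <= normc (lam n - mu).
Proof.
move=> mu0 mul.
have [M hM] := eigenvalue_decay (ev_in_s rho) (divr_gt0 (normc_gt0 mu0) (ltr0n R 2)).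
have m0 := normc_gt0 mu0.
pose d := \big[Num.min/normc mu / 2]_(m < M) normc (lam m - mu).
have d2 : d <= normc mu / 2.
  by rewrite /d; elim/big_rec : _ => // i t _ it; rewrite ge_min it orbT.
exists d.
  rewrite /d; elim/big_rec : _ => [|i t _ it]; first by rewrite divr_gt0.
  by rewrite lt_min it normc_gt0// subr_eq0 eq_sym mul.
move=> n; have [nM|nM] := ltnP n M.
  by rewrite /d (bigD1 (Ordinal nM))//= ge_min lexx.
apply: le_trans d2 _; have := hM n nM.
have := ler_normcD (mu - lam n) (lam n); rewrite subrK normc_distC; lra.
Qed.

(* [1 / (lam - mu) = - 1 / mu + lam / (mu (lam - mu))], where the last term is the
   coefficient of an element of [L(s', s)]. *)
Lemma spectrum_ev (mu : R[i]) : spectrum x mu -> mu = 0 \/ exists n, mu = lam n.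
Proof.
move=> smu; apply: contrapT => /not_orP[/eqP mu0 /forallNP mul].
have {}mul n : mu != lam n by apply/eqP; exact: mul.
apply: smu.
have [d d0 hd] := ev_separated mu0 mul.
have lm n : lam n - mu != 0 by rewrite subr_eq0 eq_sym mul.
pose c n := lam n / (mu * (lam n - mu)).
have cb : coeff_bounded P c.
  move=> q; have [C hC] := calc_coeff_bounded P_neq0 P_proj P_orth calc_ev q.
  exists ((normc mu * d)^-1 * C) => n; apply: le_trans (ler_wpM2l _ (hC n)); last first.
    by rewrite invr_ge0 mulr_ge0 ?normc_ge0// ltW.
  rewrite /c normcM normcV normcM mulrAC mulrC ler_wpM2r ?mulr_ge0 ?normc_ge0 ?ropnorm_ge0//.
  rewrite lef_pV2 ?posrE ?mulr_gt0 ?normc_gt0//.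
  by rewrite ler_wpM2l ?normc_ge0.
have [F cF] := calc_ex P_neq0 P_proj P_orth cb.
(* c_n (lambda_n - mu) = lambda_n / mu, that is, F (x - mu) = x / mu. Consequently F - 1/mu is a
   left inverse of x - mu; [xFE] does the same on the right. *)
have FxE : Lmul F x - mu *: F - mu^-1 *: x = 0.
  apply: calc_unique (calc0 P).
  apply: is_calc_ext (calcB (calcB (calc_mul P_proj P_orth cF calc_ev) (calcZ mu cF))
    (calcZ mu^-1 calc_ev)) => n.
  by rewrite /c; field; rewrite mu0 lm.
have xFE : Lmul x F - mu *: F - mu^-1 *: x = 0.
  apply: calc_unique (calc0 P).
  apply: is_calc_ext (calcB (calcB (calc_mul P_proj P_orth calc_ev cF) (calcZ mu cF))
    (calcZ mu^-1 calc_ev)) => n.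
  by rewrite /c; field; rewrite mu0 lm.
have l2opE (y : Lss R) xi : y = 0 -> l2op y xi = 0.
  by move=> ->; exact: val_inj.
have l2opB (y z w : Lss R) (xi : l2space R) :
    l2op (y - mu *: z - mu^-1 *: w) xi = l2op y xi - mu *: l2op z xi - mu^-1 *: l2op w xi.
  exact: val_inj.
have l2op0 (y : Lss R) : l2op y 0 = 0.
  by have := l2op_lin y (-1) 0 0; rewrite scaler0 addr0 scaleN1r addNr.
have l2opBl (y : Lss R) (u v : l2space R) : l2op y (u - v) = l2op y u - l2op y v.
  by rewrite addrC -scaleN1r l2op_lin scaleN1r addrC.
have l2opZ (y : Lss R) a (u : l2space R) : l2op y (a *: u) = a *: l2op y u.
  by rewrite -[a *: u]addr0 l2op_lin l2op0 addr0.
exists (fun xi => l2op F xi - mu^-1 *: xi); split.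
- move=> a u v; rewrite l2op_lin scalerDr opprD addrACA scalerBr !scalerA.
  by rewrite [mu^-1 * a]mulrC.
- exists (ropnorm 0 F + normc mu^-1) => u.
  apply: (@le_trans _ _ (wnorm 0 (Defs.sval (F (l2_to_sdual u)) + (- mu^-1) *: l2val u)%R)).
    by rewrite scaleNr.
  have fu : wfin 0 (Defs.sval (F (l2_to_sdual u)) + (- mu^-1) *: l2val u).
    by apply: wfinD; [exact: s_wfin|apply: wfinZ; exact: l2_wfin].
  rewrite (rwnormE fu) (rwnormE (l2_wfin u)) -EFinM lee_fin.
  apply: le_trans (rwnormD (s_wfin 0 (F (l2_to_sdual u))) (wfinZ _ (l2_wfin u))) _.
  rewrite mulrDl lerD//; first exact: (ropnorm_ub_l2 0 F u).
  by rewrite (rwnormZ _ (l2_wfin u)) normc_opp.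
- move=> u; have := l2opE _ u FxE; rewrite l2opB.
  rewrite -[l2op (Lmul F x) u]/(l2op F (l2op x u)) => h.
  rewrite l2opBl l2opZ scalerBr scalerA mulVf// scale1r opprB addrA addrAC.
  by rewrite h add0r.
- move=> u; have := l2opE _ u xFE; rewrite l2opB.
  rewrite -[l2op (Lmul x F) u]/(l2op x (l2op F u)) => h.
  rewrite l2opBl l2opZ scalerBr scalerA mulfV// scale1r opprB addrA addrAC.
  by rewrite [X in X + _]addrAC h add0r.
Qed.

Lemma val_at_set_val (f : spectrum x -> R[i]) (t : spectrum x) : val_at f (set_val t) = f t.
Proof. by rewrite /val_at/= oinv_set_val valK. Qed.

Lemma Cs_eq (f g : Cs rho) : (forall n, val_at f (lam n) = val_at g (lam n)) -> f = g.
Proof.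
move=> fg; apply/val_inj/funext => t.
rewrite -[\val f t]val_at_set_val -[\val g t]val_at_set_val.
have /spectrum_ev : spectrum x (set_val t) by exact: set_valP.
by move=> [->|[n ->]]; [rewrite (CsP f).1 (CsP g).1|exact: fg].
Qed.

Lemma Cs_coeff_le (f : Cs rho) q n :
  normc (val_at f (lam n)) * ropnorm q (P n) <= fine (Cs_seminorm q f).
Proof.
rewrite -lee_fin EFinM -ropnormE fineK; first exact: Cs_norm_ub.
by rewrite ge0_fin_numE; [exact: (CsP f).2|exact: Cs_norm_ge0].
Qed.

Lemma Cs_seminorm_le (f : Cs rho) q (C : R) :
  (forall n, normc (val_at f (lam n)) * ropnorm q (P n) <= C) -> (Cs_seminorm q f <= C%:E)%E.
Proof.
by move=> h; apply: ge_ereal_sup => _ [n _ <-]; rewrite ropnormE -EFinM lee_fin.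
Qed.

Lemma Cs_coeff_bounded (f : Cs rho) : coeff_bounded P (fun n => val_at f (lam n)).
Proof. by move=> q; exists (fine (Cs_seminorm q f)) => n; exact: Cs_coeff_le. Qed.

Lemma val_at_sub (f g : Cs rho) z : val_at (f - g) z = val_at f z - val_at g z.
Proof.
rewrite -[\val (f - g)]/(\val f - \val g) -scaleN1r addrC val_at_lin mulN1r.
by rewrite addrC.
Qed.

Lemma Cs_of_coeff a : coeff_bounded P a ->
  exists f : Cs rho, forall n, val_at f (lam n) = a n.
Proof.
(* [g] recovers an index from an eigenvalue by choice; injectivity of [ev] makes its value at
   lambda_n equal to a_n. *)
move=> ab; pose g (z : R[i]) :=
  if pselect (exists n, z = lam n) is left h then a (projT1 (cid h)) else 0.
have g_lam n : g (lam n) = a n.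
  rewrite /g; case: pselect => [h|[]]; last by exists n.
  by case: (cid h) => m /= e; rewrite (@ev_inj R x rho _ _ e).
have g0 : g 0 = 0.
  rewrite /g; case: pselect => // h; case: (h) => n e.
    by have := ev_neq0 rho n; rewrite -[ev rho n]e eqxx.
pose f (t : spectrum x) := g (set_val t).
have fE z : spectrum x z -> val_at f z = g z.
  move=> sz; have -> : z = set_val (exist _ z (mem_set sz) : spectrum x) by [].
  by rewrite val_at_set_val.
have fs : f \in Cs_pred rho.
  apply/asboolP; split.
    (* If 0 is a spectral point, the value there is g(0) = 0; otherwise [val_at] returns its
       default, which is 0 too. *)
    have [s0|s0] := pselect (spectrum x 0); first by rewrite fE.
    by rewrite /val_at/= oinv_set_val; case: insubP => // t; rewrite inE.
  move=> q; have [C hC] := ab q; apply: (@le_lt_trans _ _ C%:E); last exact: ltry.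
  apply: ge_ereal_sup => _ [n _ <-]; rewrite ropnormE -EFinM lee_fin.
  by rewrite fE ?g_lam//; exact: ev_in_spectrum.
exists (MkCs fs) => n; rewrite -[LHS]/(val_at f (lam n)) fE ?g_lam//.
exact: ev_in_spectrum.
Qed.

Lemma alg_val_continuous : continuous (set_val : alg x -> Lss R).
Proof. exact: initial_continuous. Qed.

Lemma calc_continuous (f : Cs rho) (y : Lss R) q (e : R) : 0 < e ->
  is_calc P (fun n => val_at f (lam n)) y ->
  (Cs_seminorm (4 * q.+1) f < (e / 2)%:E)%E -> (opnorm q y < e%:E)%E.
Proof.
move=> e0 fy fe.
have h := calc_ropnorm_le P_neq0 P_proj P_orth fy (Cs_coeff_le f (4 * q.+1)).
rewrite ropnormE lte_fin; apply: le_lt_trans h _.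
rewrite mulrC -ltr_pdivlMr// -lte_fin fineK// ge0_fin_numE; last exact: Cs_norm_ge0.
exact: (CsP f).2.
Qed.

Lemma calc_inv_continuous (f : Cs rho) (y : Lss R) q (e : R) : 0 < e ->
  is_calc P (fun n => val_at f (lam n)) y ->
  (opnorm (4 * q) y < (e / 2)%:E)%E -> (Cs_seminorm q f < e%:E)%E.
Proof.
move=> e0 fy ye; apply: (@le_lt_trans _ _ (ropnorm (4 * q) y)%:E).
  by apply: Cs_seminorm_le => n; exact: (calc_coeff_le P_neq0 P_proj P_orth n q fy).
by rewrite -ropnormE; apply: lt_trans ye _; rewrite lte_fin; lra.
Qed.

Lemma alg_ev_calc_range : alg x = calc_range P.
Proof.
apply: (alg_calc_range P_neq0 P_proj P_orth (@ev_neq0 _ _ rho) (@ev_inj _ _ rho)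
  (@ev_noninc _ _ rho) (ev_in_s rho)); exact: calc_ev.
Qed.

(** The graph of the calculus: the isomorphism and its inverse are both obtained from it by choice,
    and their properties are closure properties of the graph. *)
Definition fcalc (f : Cs rho) (y : Lss R) := is_calc P (fun n => val_at f (lam n)) y.

Lemma fcalc_alg f : exists t : alg x, fcalc f (set_val t).
Proof.
have [y fy] := calc_ex P_neq0 P_proj P_orth (Cs_coeff_bounded f).
have yA : alg x y by rewrite alg_ev_calc_range; exists (fun n => val_at f (lam n)).
by exists (exist _ y (mem_set yA)).
Qed.

Lemma alg_fcalc (t : alg x) : exists f, fcalc f (set_val t).
Proof.
have [a ay] : calc_range P (set_val t) by rewrite -alg_ev_calc_range; exact: set_valP.
have [f fa] := Cs_of_coeff (calc_coeff_bounded P_neq0 P_proj P_orth ay).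
by exists f; apply: is_calc_ext ay => n; rewrite -fa.
Qed.

Lemma fcalc_unique f y z : fcalc f y -> fcalc f z -> y = z.
Proof. exact: calc_unique. Qed.

Lemma fcalc_inj f g y : fcalc f y -> fcalc g y -> f = g.
Proof.
move=> fy gy; apply: Cs_eq => n.
by have /(congr1 (fun a => a n)) := calc_inj P_neq0 P_proj P_orth fy gy.
Qed.

Lemma fcalc_lin a f g y z : fcalc f y -> fcalc g z -> fcalc (a *: f + g) (a *: y + z).
Proof.
move=> fy gz; apply: is_calc_ext (calcD (calcZ a fy) gz) => n.
by rewrite -val_at_lin.
Qed.

Lemma fcalcB f g y z : fcalc f y -> fcalc g z -> fcalc (f - g) (y - z).
Proof.
by move=> fy gz; apply: is_calc_ext (calcB fy gz) => n; rewrite -val_at_sub.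
Qed.

Lemma fcalc_mul f g y z : fcalc f y -> fcalc g z -> fcalc (Cs_mul f g) (Lmul y z).
Proof.
move=> fy gz; apply: is_calc_ext (calc_mul P_proj P_orth fy gz) => n.
by rewrite -val_atM.
Qed.

Lemma fcalc_conj f y z : fcalc f y -> fcalc (Cs_conj f) z -> is_adjoint y z.
Proof.
move=> fy fz; apply: (calc_adjoint P_proj fy).
by apply: is_calc_ext fz => n; rewrite -val_at_conj.
Qed.

Lemma fcalc_id : fcalc (Cs_id rho) x.
Proof.
apply: is_calc_ext calc_ev => n.
have -> : lam n = set_val (exist _ (lam n) (mem_set (@ev_in_spectrum n)) : spectrum x) by [].
by rewrite val_at_set_val.
Qed.

Variable Phi : Cs rho -> alg x.
Hypothesis PhiP : forall f, fcalc f (set_val (Phi f)).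

Lemma fcalc_continuous : continuous Phi.
Proof.
apply: continuous_comp_initial => f A [q [e [e0 hA]]].
exists (4 * q.+1)%N, (e / 2); split; first by rewrite divr_gt0.
move=> g hg; apply: hA => k kq.
apply: (@calc_continuous (g - f) _ k e e0); first exact: fcalcB.
by apply: hg; lia.
Qed.

Lemma fcalc_inv_continuous (Psi : alg x -> Cs rho) :
  (forall t, fcalc (Psi t) (set_val t)) -> continuous Psi.
Proof.
move=> PsiP t A [q [e [e0 hA]]].
pose B := [set y : Lss R | forall k, (k <= 4 * q)%N ->
  (opnorm k (y - set_val t)%R < (e / 2)%:E)%E].
have hB : nbhs (set_val t : Lss R) B.
  by exists (4 * q)%N, (e / 2); split; first by rewrite divr_gt0.
have := @alg_val_continuous t B hB; rewrite !nbhs_filterE !fmapE; apply: filterS.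
move=> u hu; apply: hA => k kq.
apply: (@calc_inv_continuous (Psi u - Psi t) (set_val u - set_val t) k e e0).
  exact: fcalcB.
by apply: hu; lia.
Qed.

Lemma fcalc_frechet_algebra_iso : frechet_algebra_iso Phi.
Proof.
split.
- move=> a f g; apply: (fcalc_unique (PhiP _)); exact: fcalc_lin (PhiP f) (PhiP g).
- move=> f g; apply: (fcalc_unique (PhiP _)); exact: fcalc_mul (PhiP f) (PhiP g).
- exact: fcalc_continuous.
- have /choice[Psi PsiP] := alg_fcalc.
  exists Psi; split.
  + by move=> f; exact: fcalc_inj (PsiP (Phi f)) (PhiP f).
  + by move=> t; apply/val_inj; exact: fcalc_unique (PhiP (Psi t)) (PsiP t).
  + exact: fcalc_inv_continuous.
Qed.

End spectrum_and_calculus.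

Theorem theorem5p2 (R : realType) (x : Lss R) (rho : spectral_repr x)
    (x_normal : is_normal x) (x_infinite_rank : ~ finite_rank x) :
  exists Phi : Cs rho -> alg x,
    [/\ forall f : Cs rho,
          series (fun n => val_at f (ev rho n) *: evproj rho n) @ \oo -->
            (set_val (Phi f) : Lss R),
        frechet_algebra_iso Phi,
        set_val (Phi (Cs_id rho)) = x &
        forall f : Cs rho,
          is_adjoint (set_val (Phi f)) (set_val (Phi (Cs_conj f)))].
Proof.
have /choice[Phi PhiP] := @fcalc_alg R x rho; exists Phi; split.
- by move=> f; apply/is_calcP; exact: PhiP.
- exact: fcalc_frechet_algebra_iso.
- exact: fcalc_unique (PhiP (Cs_id rho)) (fcalc_id rho).
- by move=> f; exact: fcalc_conj (PhiP f) (PhiP (Cs_conj f)).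
Qed.
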